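(* Assume that $C=(C_\bullet,d,s,t)$ is an $H$-unital quasi-precyclic $k$-module and $k\supset\mathbb Q$. Then the $k$-linear map $\nu^{T,\natural}:C^\lambda_\bullet\to C^\natural_\bullet$ is a chain map (i.e. $(b+Bu^{-1})\nu^{T,\natural}=\nu^{T,\natural}b$) such that $$\pi^\natural\nu^{T,\natural}=1,\qquad \nu^{T,\natural}\pi^\natural=1+(b+Bu^{-1})\varphi^{T,\natural}+\varphi^{T,\natural}(b+Bu^{-1}),\qquad \pi^\natural\varphi^{T,\natural}=0 .$$ In particular, we obtain a deformation retract of $C^\natural$ to $C^\lambda$.
   Context: $k$ is a unital ring, not assumed commutative; $k$-modules are left modules. A chain map between graded modules with degree $-1$ operators (not assumed square-zero) is a degree $0$ $k$-linear map commuting with these operators; a deformation retract is given by chain maps $f,g$ with $fg=1$ and $gf$ chain homotopic to $1$. A para-precyclic $k$-module consists of $k$-modules $C_m$, $m\ge0$, face maps $d_j:C_m\to C_{m-1}$ ($0\le j\le m$) with $d_id_j=d_{j-1}d_i$ for $i<j$, and an invertible $k$-linear map $t:C_\bullet\to C_\bullet$ of degree $0$ with $td_i=d_{i+1}t$ for $0\le i\le m-1$ and $d_m=d_0t$ on $C_m$ (notation: $d=d_m$ on $C_m$). Put $T=t^{m+1}$ on $C_m$; it commutes with $d$ and $t$. Let $b=\sum_{j=0}^m(-1)^jd_j$, $b'=\sum_{j=0}^{m-1}(-1)^jd_j$, $\tau=(-1)^mt$, $N=1+\tau+\cdots+\tau^m$ on $C_m$. It is $H$-unital, written $(C_\bullet,d,s,t)$,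 when equipped with a $k$-linear map $s:C_\bullet\to C_{\bullet+1}$ commuting with $T$ with $b's+sb'=1$. Put $s'=sb's$ and $B=(1-\tau)s'N:C_\bullet\to C_{\bullet+1}$. Then $b^2=B^2=0$ and $bB+Bb=1-T$. It is quasi-precyclic if $C_\bullet=\ker(1-T)\oplus\operatorname{ran}(1-T)$; then $\pi^T$ is the projection onto $\ker(1-T)$ along $\operatorname{ran}(1-T)$, $x^T:=\pi^T(x)$, and $1-T$ is invertible on $\operatorname{ran}(1-T)$. $C^\natural_m=\bigoplus_{2p\le m}C_{m-2p}u^p$ and $C^{\natural\natural}_m=\bigoplus_{p+q=m}C_qu^p$ ($u$ a formal variable; $u^{-1}(xu^p)=xu^{p-1}$ for $p\ge1$, $u^{-1}(xu^0)=0$; operators on $C_\bullet$ act on coefficients). $C^\natural$ carries the operator $b+Bu^{-1}$, with $(b+Bu^{-1})^2=(1-T)u^{-1}$. On $C^{\natural\natural}_\bullet$ put $\delta(xu^{2p})=bxu^{2p}$, $\delta(xu^{2p+1})=-b'xu^{2p+1}$. $C^\lambda=(C^\lambda_\bullet,b)$, $C^\lambda_m=C_m/\operatorname{ran}(1-\tau)$, with $b$ induced by $b$; $\pi^\lambda:C_\bullet\to C^\lambda_\bullet$ is the canonical projection. $\pi^\natural:C^\natural_\bullet\to C^\lambda_\bullet$ is $\pi^\natural(xu^0)=\pi^\lambda(x)$, $\pi^\natural(xu^p)=0$ for $p\ge1$. Define $I:C^\natural_\bullet\to C^{\natural\natural}_\bullet$ by $I(xu^0)=xu^0$, $I(xu^p)=xu^{2p}+s'Nxu^{2p-1}$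 ($p\ge1$), and $J:C^{\natural\natural}_\bullet\to C^\natural_\bullet$ by $J(xu^{2p})=xu^p$, $J(xu^{2p+1})=(1-\tau)s'xu^p$. For $x\in C_m$ put $\hat x=(m+1)^{-1}x$, $\hat Nx=N\hat x$, $\hat Dx=\sum_{j=0}^m(m-j)\tau^j\hat x$. Define $\nu(x)=\hat Nx\,u^0\in C^{\natural\natural}$; $\varphi(xu^{2p})=-\hat Dx\,u^{2p+1}$, $\varphi(xu^{2p+1})=-\hat x\,u^{2p+2}$ on $C^{\natural\natural}_\bullet$; $\varphi^{\natural\natural}=\sum_{j\ge0}(\varphi\delta)^j\varphi$; $\nu_0^{\natural\natural}=\sum_{j\ge0}(\varphi\delta)^j\nu$. Put $\nu_0^\natural=J\nu_0^{\natural\natural}:C_\bullet\to C^\natural_\bullet$ and $\varphi^\natural=J\varphi^{\natural\natural}I:C^\natural_\bullet\to C^\natural_{\bullet+1}$. The map $\pi^T\nu_0^\natural$ vanishes on $\operatorname{ran}(1-\tau)$, and $\nu^{T,\natural}:C^\lambda_\bullet\to C^\natural_\bullet$ is defined by $\nu^{T,\natural}\pi^\lambda=\pi^T\nu_0^\natural$. With $h(x)=-B(1-T)^{-1}(x-x^T)$ acting on coefficients, $\varphi^{T,\natural}=h+\varphi^\natural\pi^T:C^\natural_\bullet\to C^\natural_{\bullet+1}$. *)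

(* Defs.v *)
From HB Require Import structures.
From mathcomp Require Import all_boot all_order all_algebra.
From mathcomp Require Import boolp classical_sets.

Set Implicit Arguments.
Unset Strict Implicit.
Unset Printing Implicit Defensive.

Import GRing.Theory.
Local Open Scope ring_scope.
Local Open Scope quotient_scope.

(* The quotient of a module by the range of an endomorphism. *)

Section Coker.
Variables (k : pzRingType) (V : lmodType k) (f : {linear V -> V}).

Definition ran : {pred V} := [pred x | `[< exists y, x = f y >]].

Lemma ranP x : reflect (exists y, x = f y) (x \in ran).
Proof. exact: asboolP. Qed.

Lemma ran_zmod_closed : zmod_closed ran.
Proof.
split=> [|x y /ranP[x' ->] /ranP[y' ->]]; apply/ranP.
  by exists 0; rewrite linear0.
by exists (x' - y'); rewrite linearB.
Qed.

HB.instance Definition _ := GRing.isZmodClosed.Build V ran ran_zmod_closed.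

Lemma ranZ a x : x \in ran -> a *: x \in ran.
Proof. by move=> /ranP[y ->]; apply/ranP; exists (a *: y); rewrite linearZ. Qed.

Definition coker : Type := Quotient.quot ran.

HB.instance Definition _ := GRing.Zmodule.on coker.

Definition coker_pi (x : V) : coker := \pi_(Quotient.quot ran) x.
Definition coker_repr (z : coker) : V := repr (z : Quotient.quot ran).

Lemma coker_reprK : cancel coker_repr coker_pi.
Proof. exact: reprK. Qed.

Lemma coker_piP x y : reflect (exists z, x - y = f z) (coker_pi x == coker_pi y).
Proof.
have -> : (coker_pi x == coker_pi y) = (x - y \in ran).
  by rewrite Quotient.idealrBE.
exact: ranP.
Qed.

Lemma coker_piD x y : coker_pi (x + y) = coker_pi x + coker_pi y.
Proof. exact: (raddfD \pi_(Quotient.quot ran)). Qed.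

Definition coker_scale (a : k) (z : coker) : coker := coker_pi (a *: coker_repr z).

Lemma coker_scaleE a x : coker_scale a (coker_pi x) = coker_pi (a *: x).
Proof.
have /eqP/coker_piP[y xy] := coker_reprK (coker_pi x).
by apply/eqP/coker_piP; exists (a *: y); rewrite -scalerBr xy linearZ.
Qed.

Let coker_scaleA a b z : coker_scale a (coker_scale b z) = coker_scale (a * b) z.
Proof. by rewrite -(coker_reprK z) !coker_scaleE scalerA. Qed.

Let coker_scale1 : left_id 1 coker_scale.
Proof. by move=> z; rewrite -(coker_reprK z) coker_scaleE scale1r. Qed.

Let coker_scaleDr : right_distributive coker_scale +%R.
Proof.
move=> a y z; rewrite -(coker_reprK y) -(coker_reprK z).
by rewrite -coker_piD !coker_scaleE scalerDr coker_piD.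
Qed.

Let coker_scaleDl z : {morph coker_scale^~ z : a b / a + b}.
Proof.
by move=> a b; rewrite -(coker_reprK z) !coker_scaleE scalerDl coker_piD.
Qed.

HB.instance Definition _ := GRing.Zmodule_isLmodule.Build k coker
  coker_scaleA coker_scale1 coker_scaleDr coker_scaleDl.

Lemma coker_pi_linear : linear coker_pi.
Proof. by move=> a x y; rewrite coker_piD -coker_scaleE. Qed.

HB.instance Definition _ :=
  GRing.isLinear.Build k V coker *:%R coker_pi coker_pi_linear.

End Coker.

(* The direct sum of a finite family of modules. *)

Section DirectSum.
Variables (k : pzRingType) (I : finType) (M : I -> lmodType k).

Definition dsum : Type := {dffun forall i, M i}.

HB.instance Definition _ := Choice.on dsum.

Definition dsum_of (g : forall i, M i) : dsum := [ffun i : I => g i : M i].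
Definition dsum_nth (i : I) (z : dsum) : M i := (z : {dffun forall i, M i}) i.

Lemma dsum_ofE g i : dsum_nth i (dsum_of g) = g i.
Proof. by rewrite /dsum_nth ffunE. Qed.

Lemma dsumP z1 z2 : (forall i, dsum_nth i z1 = dsum_nth i z2) <-> z1 = z2.
Proof. by split=> [/ffunP|->]. Qed.

Let add (z1 z2 : dsum) := dsum_of (fun i => dsum_nth i z1 + dsum_nth i z2).
Let opp (z : dsum) := dsum_of (fun i => - dsum_nth i z).
Let zero := dsum_of (fun => 0).
Let scale (a : k) (z : dsum) := dsum_of (fun i => a *: dsum_nth i z).

Let addA : associative add.
Proof. by move=> x y z; apply/dsumP=> i; rewrite !dsum_ofE addrA. Qed.
Let addC : commutative add.
Proof. by move=> x y; apply/dsumP=> i; rewrite !dsum_ofE addrC. Qed.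
Let add0 : left_id zero add.
Proof. by move=> x; apply/dsumP=> i; rewrite !dsum_ofE add0r. Qed.
Let addN : left_inverse zero opp add.
Proof. by move=> x; apply/dsumP=> i; rewrite !dsum_ofE addNr. Qed.

HB.instance Definition _ := GRing.isZmodule.Build dsum addA addC add0 addN.

Let scaleA a b z : scale a (scale b z) = scale (a * b) z.
Proof. by apply/dsumP=> i; rewrite !dsum_ofE scalerA. Qed.
Let scale1 : left_id 1 scale.
Proof. by move=> z; apply/dsumP=> i; rewrite !dsum_ofE scale1r. Qed.
Let scaleDr : right_distributive scale +%R.
Proof. by move=> a y z; apply/dsumP=> i; rewrite !dsum_ofE scalerDr. Qed.
Let scaleDl z : {morph scale^~ z : a b / a + b}.
Proof. by move=> a b; apply/dsumP=> i; rewrite !dsum_ofE scalerDl. Qed.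

HB.instance Definition _ := GRing.Zmodule_isLmodule.Build k dsum
  scaleA scale1 scaleDr scaleDl.

Lemma dsum_nth_linear i : linear (dsum_nth i).
Proof. by move=> a x y; rewrite !dsum_ofE. Qed.

HB.instance Definition _ i :=
  GRing.isLinear.Build k dsum (M i) *:%R (dsum_nth i) (dsum_nth_linear i).

End DirectSum.

(* Nonnegatively graded modules.  An operator of degree -1 is a family of maps
   X_(m+1) -> Y_m; on X_0 it is zero, since Y_(-1) = 0. *)

Notation graded k := (nat -> lmodType k).

Section Graded.
Variable k : pzRingType.

Section Operators.
Variables X Y Z : graded k.

Definition updown (g : forall m, Y m -> Z m.+1) (f : forall m, X m.+1 -> Y m) m :
    X m -> Z m :=
  match m with 0 => fun=> 0 | n.+1 => fun x => g n (f n x) end.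

Definition dn (f : forall m, X m.+1 -> Y m) m : X m -> Y m.-1 :=
  match m with 0 => fun=> 0 | n.+1 => f n end.

End Operators.

Definition chain_map (X Y : graded k) (DX : forall m, X m.+1 -> X m)
    (DY : forall m, Y m.+1 -> Y m) (f : forall m, X m -> Y m) :=
  (forall m, linear (f m)) /\
  forall m (x : X m.+1), DY m (f m.+1 x) = f m (DX m x).

(* [h] is a homotopy from the identity to [f], i.e. f = 1 + D h + h D. *)
Definition homotopy_to_id (X : graded k) (D : forall m, X m.+1 -> X m)
    (h : forall m, X m -> X m.+1) (f : forall m, X m -> X m) :=
  (forall m, linear (h m)) /\
  forall m (x : X m), f m x = x + D m (h m x) + updown h D x.

Definition deformation_retract (X Y : graded k) (DX : forall m, X m.+1 -> X m)
    (DY : forall m, Y m.+1 -> Y m) (f : forall m, X m -> Y m)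
    (g : forall m, Y m -> X m) :=
  [/\ chain_map DX DY f, chain_map DY DX g, (forall m y, f m (g m y) = y)
    & exists h, homotopy_to_id DX h (fun m x => g m (f m x))].

(* [upoly e X m] is the degree m part of the module of polynomials in u with
   coefficients in X, where u has degree e > 0: the direct sum of the
   X_(m - e p) u^p for e p <= m. *)

Definition upoly (e : nat) (X : graded k) : graded k :=
  fun m => dsum (fun p : 'I_(m %/ e).+1 => X (m - e * p)%N).

(* The identity of X_q = X_r if q = r, and zero otherwise. *)
Definition regrade (X : graded k) q r (x : X q) : X r :=
  if eqVneq q r is EqNotNeq qr then ecast i (X i) qr x else 0.

(* [x *u^ p] is x u^p, in degree m: the monomial is zero unless x has degree
   m - e p; e and m are read off the expected type. *)
Definition umon (e : nat) (X : graded k) (m p q : nat) (x : X q) : upoly e X m :=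
  dsum_of (fun i : 'I_(m %/ e).+1 =>
    if i == p :> nat then regrade (m - e * i) x else 0).

(* The linear map with x u^p |-> f p x. *)
Definition ulift (e : nat) (X : graded k) m (V : lmodType k)
    (f : forall p q : nat, X q -> V) (z : upoly e X m) : V :=
  \sum_(i < (m %/ e).+1) f i (m - e * i)%N (dsum_nth i z).

Lemma regrade_id (X : graded k) q (x : X q) : regrade q x = x.
Proof.
rewrite /regrade; case: eqVneq => [qq|/eqP//].
by rewrite (eq_irrelevance qq erefl).
Qed.

Lemma ulift_umon (e : nat) (X : graded k) (V : lmodType k)
    (f : forall p q : nat, X q -> V) m p q (x : X q) :
    (0 < e)%N -> m = (e * p + q)%N -> (forall p q, f p q 0 = 0) ->
  ulift f (umon e m p x) = f p q x.
Proof.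
move=> e_gt0 mE f0; have p_lt : (p < (m %/ e).+1)%N.
  by rewrite ltnS leq_divRL // mE mulnC leq_addr.
rewrite /ulift (bigD1 (Ordinal p_lt)) //= big1 ?addr0 => [|i /negPf ip].
  rewrite dsum_ofE eqxx.
  have -> : (m - e * p)%N = q by rewrite mE addKn.
  by rewrite regrade_id.
by rewrite dsum_ofE -[_ == p]/(i == Ordinal p_lt) ip f0.
Qed.

End Graded.

Notation "x *u^ p" := (umon _ _ p x) (at level 40, p at level 2).

(* [pc_d m j] is the face d_j on C_(m+1);
   only its values for j <= m.+1 are constrained or used. *)

Record para_precyclic (k : pzRingType) := ParaPrecyclic {
  pc_mod :> graded k;
  pc_d : forall m, nat -> {linear pc_mod m.+1 -> pc_mod m};
  pc_t : forall m, {linear pc_mod m -> pc_mod m};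
  pc_dd : forall m i j (x : pc_mod m.+2), (i < j <= m.+2)%N ->
    pc_d m i (pc_d m.+1 j x) = pc_d m j.-1 (pc_d m.+1 i x);
  pc_t_bij : forall m, bijective (pc_t m);
  pc_td : forall m i (x : pc_mod m.+1), (i <= m)%N ->
    pc_t m (pc_d m i x) = pc_d m i.+1 (pc_t m.+1 x);
  pc_d_last : forall m (x : pc_mod m.+1),
    pc_d m m.+1 x = pc_d m 0 (pc_t m.+1 x)
}.

Section ParaPrecyclic.
Variables (k : pzRingType) (C : para_precyclic k).

Definition bigT m (x : C m) : C m := iter m.+1 (pc_t C m) x.

Definition bop m (x : C m.+1) : C m :=
  \sum_(j < m.+2) (-1) ^+ j *: pc_d C m j x.

Definition bop' m (x : C m.+1) : C m :=
  \sum_(j < m.+1) (-1) ^+ j *: pc_d C m j x.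

Definition tau m (x : C m) : C m := (-1) ^+ m *: pc_t C m x.

Definition Nop m (x : C m) : C m := \sum_(j < m.+1) iter j (@tau m) x.

Definition one_tau m (x : C m) : C m := x - tau x.

Lemma one_tau_linear m : linear (@one_tau m).
Proof.
move=> a x y; rewrite /one_tau /tau linearP !scalerDr !scalerA.
by rewrite -commr_sign -!scalerA opprD addrACA scalerN.
Qed.

HB.instance Definition _ m :=
  GRing.isLinear.Build k (C m) (C m) *:%R (@one_tau m) (@one_tau_linear m).

Definition ker_one_T m (x : C m) := bigT x = x.
Definition ran_one_T m (x : C m) := exists y : C m, x = y - bigT y.

(* C_m is the direct sum of ker(1 - T) and ran(1 - T). *)
Definition quasi_precyclic :=
  forall m,
    (forall x : C m, exists y z, [/\ ker_one_T y, ran_one_T z & x = y + z]) /\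
    (forall x : C m, ker_one_T x -> ran_one_T x -> x = 0).

(* When C is quasi-precyclic, [piT] is the projection onto ker(1 - T) along
   ran(1 - T), and [inv_one_T] the inverse of 1 - T on ran(1 - T). *)
Definition piT m (x : C m) : C m :=
  xget 0 [set y | ker_one_T y /\ ran_one_T (x - y)].

Definition inv_one_T m (y : C m) : C m :=
  xget 0 [set z | ran_one_T z /\ z - bigT z = y].

Definition Clambda : graded k := fun m => coker (@one_tau m).

Definition pi_lambda m (x : C m) : Clambda m := coker_pi (@one_tau m) x.

(* The maps induced on C^lambda are defined through representatives. *)
Definition b_lambda m (z : Clambda m.+1) : Clambda m :=
  pi_lambda (bop (coker_repr z)).

End ParaPrecyclic.

Record hunital (k : pzRingType) := HUnital {
  hu_mod :> para_precyclic k;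
  hu_s : forall m, {linear hu_mod m -> hu_mod m.+1};
  hu_sT : forall m (x : hu_mod m), hu_s m (bigT x) = bigT (hu_s m x);
  hu_bs : forall m (x : hu_mod m),
    bop' (hu_s m x) + updown hu_s (@bop' k hu_mod) x = x
}.

Section HUnital.
Variables (k : pzRingType) (C : hunital k).

Definition sop' m (x : C m) : C m.+1 := hu_s C m (bop' (hu_s C m x)).

Definition Bop m (x : C m) : C m.+1 := one_tau (sop' (Nop x)).

Definition Cn : graded k := upoly 2 C.
Definition Cnn : graded k := upoly 1 C.

(* b + B u^-1 *)
Definition bB m (z : Cn m.+1) : Cn m :=
  ulift (fun p q (x : C q) => dn (@bop k C) x *u^ p +
                      (if p is p'.+1 then Bop x *u^ p' else 0)) z.

Definition delta m (z : Cnn m.+1) : Cnn m :=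
  ulift (fun n q (x : C q) => if odd n then - dn (@bop' k C) x *u^ n
                      else dn (@bop k C) x *u^ n) z.

Definition pi_natural m (z : Cn m) : Clambda C m :=
  ulift (fun p q (x : C q) => if p == 0%N then pi_lambda (regrade m x) else 0) z.

Definition Imap m (z : Cn m) : Cnn m :=
  ulift (fun p q (x : C q) => if p is p'.+1
                      then x *u^ (2 * p) + sop' (Nop x) *u^ (2 * p').+1
                      else x *u^ 0) z.

Definition Jmap m (z : Cnn m) : Cn m :=
  ulift (fun n q (x : C q) => if odd n then one_tau (sop' x) *u^ (n./2)
                      else x *u^ (n./2)) z.

Definition piT_natural m (z : Cn m) : Cn m :=
  ulift (fun p q (x : C q) => piT x *u^ p) z.

Definition hmap m (z : Cn m) : Cn m.+1 :=
  ulift (fun p q (x : C q) => (- Bop (inv_one_T (x - piT x))) *u^ p) z.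

Section Rational.
(* The inclusion of the rationals in k (automatically injective when k is not
   the zero ring, and with central image). *)
Variable iota : {rmorphism rat -> k}.

Definition hat m (x : C m) : C m := iota (m.+1%:R^-1) *: x.

Definition Nhat m (x : C m) : C m := Nop (hat x).

Definition Dhat m (x : C m) : C m :=
  \sum_(j < m.+1) iter j (@tau k C m) (hat x) *+ (m - j).

Definition nu m (x : C m) : Cnn m := Nhat x *u^ 0.

Definition phi m (z : Cnn m) : Cnn m.+1 :=
  ulift (fun n q (x : C q) => if odd n then (- hat x) *u^ n.+1
                      else (- Dhat x) *u^ n.+1) z.

Definition phidelta m (z : Cnn m) : Cnn m := updown phi delta z.

(* The series of the (phi delta)^j: on degree m the terms with j > m vanish,
   see [phidelta_nilp]. *)
Definition phidelta_series m (z : Cnn m) : Cnn m :=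
  \sum_(j < m.+1) iter j (@phidelta m) z.

Definition phi_nn m (z : Cnn m) : Cnn m.+1 := phidelta_series (phi z).
Definition nu0_nn m (x : C m) : Cnn m := phidelta_series (nu x).

Definition nu0_n m (x : C m) : Cn m := Jmap (nu0_nn x).
Definition phi_n m (z : Cn m) : Cn m.+1 := Jmap (phi_nn (Imap z)).

Definition nuT_n m (z : Clambda C m) : Cn m :=
  piT_natural (nu0_n (coker_repr z)).

Definition phiT_n m (z : Cn m) : Cn m.+1 := hmap z + phi_n (piT_natural z).

Lemma phidelta_nilp m (z : Cnn m) : iter m.+1 (@phidelta m) z = 0.
Proof.
pose low j n (y : Cnn n) := forall i : 'I_(n %/ 1).+1,
  (i < j)%N -> dsum_nth i y = 0.
have lift_low j l n n' (f : forall p q, C q -> Cnn n') (y : Cnn n) :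
    (forall p q, f p q 0 = 0) ->
    (forall p q x (i : 'I_(n' %/ 1).+1),
       (i < p + l)%N -> dsum_nth i (f p q x) = 0) ->
    low j n y -> low (j + l)%N n' (ulift f y).
  move=> f0 fl yj i ij; rewrite /ulift linear_sum big1 //= => p _.
  have [pj|jp] := ltnP p j; first by rewrite yj // f0 linear0.
  by rewrite fl // (leq_trans ij) // leq_add2r.
have mon_low n p q (x : C q) (i : 'I_(n %/ 1).+1) :
    (i < p)%N -> dsum_nth i (x *u^ p : Cnn n) = 0.
  by move=> ip; rewrite dsum_ofE ltn_eqF.
have regrade0 q r : regrade r (0 : C q) = 0.
  by rewrite /regrade; case: eqVneq => // qr; case: r / qr.
have mon0 n p q : ((0 : C q) *u^ p : Cnn n) = 0.
  by apply/dsumP=> i; rewrite dsum_ofE regrade0 linear0; case: ifP.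
have b0 q : dn (@bop k C) (0 : C q) = 0.
  by case: q => //= q; rewrite /bop big1 // => j _; rewrite linear0 scaler0.
have b'0 q : dn (@bop' k C) (0 : C q) = 0.
  by case: q => //= q; rewrite /bop' big1 // => j _; rewrite linear0 scaler0.
have hat0 q : hat (0 : C q) = 0 by exact: scaler0.
have Dhat0 q : Dhat (0 : C q) = 0.
  rewrite /Dhat hat0 big1 // => j _.
  have -> : iter j (@tau k C q) 0 = 0.
    by elim: (nat_of_ord j) => //= {}j ->; rewrite /tau linear0 scaler0.
  by rewrite mul0rn.
have step j y : low j m y -> low j.+1 m (phidelta y).
  rewrite /phidelta => yj; case: m y yj {z} => [|n] y yj.
    by move=> i _; rewrite linear0.
  rewrite -addn1 /=; apply: (lift_low) => [p q|p q x i ip|].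
  - by case: ifP; rewrite ?hat0 ?Dhat0 oppr0 mon0.
  - by case: ifP => _; apply: mon_low; rewrite addn1 in ip.
  - rewrite -[j]addn0; apply: (lift_low) yj => [p q|p q x i ip].
      by case: ifP; rewrite ?b0 ?b'0 ?oppr0 mon0.
    by case: ifP => _; apply: mon_low; rewrite addn0 in ip.
have lowI j : low j m (iter j (@phidelta m) z).
  by elim: j => [|j IHj]; [move=> i | apply: step].
apply/dsumP=> i; rewrite linear0; apply: lowI.
by have := ltn_ord i; rewrite {2}divn1.
Qed.

End Rational.
End HUnital.

(* Main.v *)
Require Import Defs.
From HB Require Import structures.
From mathcomp Require Import all_boot all_order all_algebra.
From mathcomp Require Import zify.
From mathcomp Require Import boolp classical_sets functions.

(** The proof is homological perturbation on the cyclic bicomplex, followed by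
    the removal of the range of 1 - T.

    Complete the vertical differential delta by the horizontal differential
    partial, with entries N and 1 - tau, and set Q = delta + partial.  The maps
    phi contract the rows: partial phi + phi partial = -1 + P, where P is Nhat
    on the u^0 column and zero elsewhere ([partial_phi]).  With
    R = 1 + phi delta + (phi delta)^2 + ..., the perturbation lemma
    [R_phi_homotopy] reads R P = 1 + Q R phi + R phi Q.  Besides
    the row contraction, its proof uses delta^2 = 0 and
    delta partial = - partial delta, which hold on all of C; this is why the
    formula holds although Q^2 = (1 - T) u^-2.

    The maps I and J intertwine b + B u^-1 with Q and satisfy J I = 1
    ([I_s_chain], [J_s_chain], [J_sI_s]); conjugation by them gives the same
    identity on the mixed side ([nu0_homotopy]).  The operator
    h = -B (1 - T)^-1 (1 - pi^T) contracts the range of 1 - T, because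
    bB + Bb = 1 - T and B^2 = 0 ([h_s_homotopy]); composing both homotopies yields
    the formula for [nuT] ([nuT_homotopy]).  That [nuT] is a chain map then
    follows formally: the homotopy formula expresses its failure through
    (b + B u^-1)^2 = (1 - T) u^-1, which pi^T kills ([nuT_chain]).  The two identities
    for pi^natural hold because everything that the correction terms contribute
    to u^0 lies in the range of 1 - tau.

    All these computations are made with ungraded operators: a graded polynomial
    is embedded ([emb]) into the series in u with coefficients in the product of
    all C_q ([gprod]), where all operators are endomorphisms of one module, and
    each graded operator is matched with an ungraded one on monomials. *)

Set Implicit Arguments.
Unset Strict Implicit.
Unset Printing Implicit Defensive.

Import GRing.Theory.
Local Open Scope ring_scope.

(** * Signed faces and cyclic identities *)

Section Cyclic.
Variables (k : pzRingType) (C : para_precyclic k).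

Lemma tau_linear m : linear (@tau k C m).
Proof.
move=> a x y; rewrite /tau linearP scalerDr !scalerA.
by rewrite -commr_sign.
Qed.

HB.instance Definition _ m :=
  GRing.isLinear.Build k (C m) (C m) *:%R (@tau k C m) (@tau_linear m).

Lemma iter_linear (V : lmodType k) (f : {linear V -> V}) j : linear (iter j f).
Proof. by elim: j => // j IH a x y /=; rewrite IH linearP. Qed.

HB.instance Definition _ (V : lmodType k) (f : {linear V -> V}) j :=
  GRing.isLinear.Build k V V *:%R (iter j f) (iter_linear f j).

HB.instance Definition _ m :=
  GRing.isLinear.Build k (C m) (C m) *:%R (@bigT k C m)
  (iter_linear (pc_t C m) m.+1).

(** With its sign, each face is conjugate under [tau] to the zeroth one, and no
    sign is left in the identities below. *)
Definition sface m i (x : C m.+1) : C m := (-1) ^+ i *: pc_d C m i x.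

Lemma sface_linear m i : linear (@sface m i).
Proof.
move=> a x y; rewrite /sface linearP scalerDr !scalerA.
by rewrite -commr_sign.
Qed.

HB.instance Definition _ m i :=
  GRing.isLinear.Build k (C m.+1) (C m) *:%R (@sface m i) (@sface_linear m i).

Lemma sum_linear (U V : lmodType k) n (f : nat -> {linear U -> V}) :
  linear (fun x => \sum_(i < n) f i x).
Proof.
move=> a x y; rewrite scaler_sumr -big_split /=.
by apply: eq_bigr => i _; rewrite linearP.
Qed.

HB.instance Definition _ m :=
  GRing.isLinear.Build k (C m.+1) (C m) *:%R (@bop k C m)
  (sum_linear m.+2 (@sface m)).
HB.instance Definition _ m :=
  GRing.isLinear.Build k (C m.+1) (C m) *:%R (@bop' k C m)
  (sum_linear m.+1 (@sface m)).
HB.instance Definition _ m :=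
  GRing.isLinear.Build k (C m) (C m) *:%R (@Nop k C m)
  (sum_linear m.+1 (fun j => iter j (@tau k C m))).

Definition one_T m (x : C m) : C m := x - bigT x.

Lemma one_T_linear m : linear (@one_T m).
Proof. by move=> a x y; rewrite /one_T linearP opprD addrACA -scalerBr. Qed.

HB.instance Definition _ m :=
  GRing.isLinear.Build k (C m) (C m) *:%R (@one_T m) (@one_T_linear m).

Lemma tau_sface m i (x : C m.+1) : (i <= m)%N ->
  tau (sface i x) = sface i.+1 (tau x).
Proof.
move=> im; rewrite /tau /sface !linearZ_LR /= pc_td // !scalerA -!exprD.
by congr (_ *: _); rewrite addSn addnS addnC !exprS !mulN1r opprK.
Qed.

Lemma sface_last m (x : C m.+1) : sface m.+1 x = sface 0 (tau x).
Proof. by rewrite /sface pc_d_last /tau linearZ_LR /= expr0 scale1r. Qed.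

Lemma sface_iter_tau m j (x : C m.+1) : (j <= m.+1)%N ->
  sface j (iter j (@tau k C m.+1) x) = iter j (@tau k C m) (sface 0 x).
Proof.
elim: j x => // j IH x jm.
by rewrite [in RHS]iterS -IH 1?ltnW // tau_sface.
Qed.

Lemma iter_tauE m j (x : C m) :
  iter j (@tau k C m) x = (-1) ^+ (m * j) *: iter j (pc_t C m) x.
Proof.
elim: j x => [|j IH] x; first by rewrite muln0 scale1r.
by rewrite !iterS IH /tau linearZ_LR scalerA -exprD mulnS.
Qed.

(** The sign of [tau ^ (m+1)] is (-1)^(m(m+1)) = 1. *)
Lemma iter_tau_bigT m (x : C m) : iter m.+1 (@tau k C m) x = bigT x.
Proof. by rewrite iter_tauE -signr_odd oddM /= andbN scale1r. Qed.

Lemma tau_bigT m (x : C m) : tau (bigT x) = bigT (tau x).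
Proof. by rewrite -!iter_tau_bigT -iterS iterSr. Qed.

(** Invertibility of [t] in the form suited to faces: an identity about the j-th
    face may be checked on elements [tau ^ j y], where [sface_iter_tau]
    turns it into one about the zeroth face. *)
Lemma iter_tau_surj m j (x : C m) : exists y, x = iter j (@tau k C m) y.
Proof.
elim: j x => [|j IH] x; first by exists x.
have [g _ gK] := @pc_t_bij _ C m.
have [y ->] := IH x.
exists (g ((-1) ^+ m *: y)); rewrite iterSr /tau gK scalerA -exprD.
by rewrite -[_ ^+ (m + m)]signr_odd oddD addbb scale1r.
Qed.

(** On the target, [T] is one power of [tau] short of the [T] of the source; carrying
    the zeroth face to the last one, which is [sface 0] after [tau], supplies it. *)
Lemma sface0_bigT m (x : C m.+1) : sface 0 (bigT x) = bigT (sface 0 x).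
Proof.
rewrite -[bigT (sface _ _)]iter_tau_bigT -sface_iter_tau // sface_last -iterS.
by rewrite iter_tau_bigT.
Qed.

Lemma iter_tau_bigTC m j (x : C m) :
  iter j (@tau k C m) (bigT x) = bigT (iter j (@tau k C m) x).
Proof. by elim: j => // j /= ->; rewrite tau_bigT. Qed.

Lemma sface_bigT m j (x : C m.+1) : (j <= m.+1)%N ->
  sface j (bigT x) = bigT (sface j x).
Proof.
move=> jm; have [y ->] := iter_tau_surj j x.
rewrite -iter_tau_bigTC sface_iter_tau // sface0_bigT.
by rewrite sface_iter_tau // iter_tau_bigTC.
Qed.

Lemma bopE m (x : C m.+1) : bop x = \sum_(j < m.+2) sface j x.
Proof. by []. Qed.

Lemma bop'E m (x : C m.+1) : bop' x = \sum_(j < m.+1) sface j x.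
Proof. by []. Qed.

Lemma bop_bigT m (x : C m.+1) : bop (bigT x) = bigT (bop x).
Proof.
by rewrite !bopE linear_sum; apply: eq_bigr => j _; rewrite sface_bigT // -ltnS.
Qed.

Lemma bop'_bigT m (x : C m.+1) : bop' (bigT x) = bigT (bop' x).
Proof.
rewrite !bop'E linear_sum; apply: eq_bigr => j _.
by rewrite sface_bigT // ltnW.
Qed.

Lemma Nop_bigT m (x : C m) : Nop (bigT x) = bigT (Nop x).
Proof.
by rewrite /Nop linear_sum; apply: eq_bigr => j _; rewrite iter_tau_bigTC.
Qed.

Lemma one_tau_bigT m (x : C m) : one_tau (bigT x) = bigT (one_tau x).
Proof. by rewrite /one_tau tau_bigT linearB. Qed.

(** A telescoping sum, whose end term is [tau ^ (m+1) = T]. *)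
Lemma Nop_one_tau m (x : C m) : Nop (one_tau x) = one_T x.
Proof.
rewrite /Nop /one_tau /one_T -iter_tau_bigT.
under eq_bigr do rewrite linearB /= -iterSr -opprB.
rewrite sumrN -(big_mkord predT
  (fun i => iter i.+1 (@tau k C m) x - iter i (@tau k C m) x)).
by rewrite telescope_sumr // opprB.
Qed.

Lemma one_tau_Nop m (x : C m) : one_tau (Nop x) = one_T x.
Proof.
rewrite -Nop_one_tau [RHS]linearB /= /one_tau; congr (_ - _).
by rewrite /Nop linear_sum; apply: eq_bigr => j _; rewrite -iterSr.
Qed.

Lemma bop_one_tau m (x : C m.+1) : bop (one_tau x) = one_tau (bop' x).
Proof.
rewrite {1}/one_tau linearB /=.
have -> : bop x = bop' x + sface 0 (tau x).
  by rewrite bopE big_ord_recr sface_last.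
have tb : bop (tau x) = sface 0 (tau x) + tau (bop' x).
  rewrite bopE big_ord_recl bop'E linear_sum; congr (_ + _).
  by apply: eq_bigr => j _; rewrite -tau_sface // -ltnS.
by rewrite tb opprD addrA addrK.
Qed.

(** A face [sface l] with l + i <= m passes through [tau ^ i] and becomes
    [sface (l + i)].  The other faces run past the last one, reappear as the
    initial faces, and acquire one more [tau] on the way. *)
Lemma iter_tau_bop m i (x : C m.+1) : (i <= m)%N ->
  iter i (@tau k C m) (bop x) =
    \sum_(i <= l < m.+1) sface l (iter i (@tau k C m.+1) x)
    + \sum_(0 <= l < i.+1) sface l (iter i.+1 (@tau k C m.+1) x).
Proof.
elim: i => [|i IH] im.
  by rewrite big_nat1 /= bopE big_ord_recr sface_last /= big_mkord.
rewrite iterS IH 1?ltnW // linearD /= !linear_sum.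
have tau_sum n p (y : C m.+1) : (p <= m.+1)%N ->
    \sum_(n <= l < p) tau (sface l y) = \sum_(n.+1 <= l < p.+1) sface l (tau y).
  move=> pm; rewrite big_add1; apply: eq_big_nat => l /andP[_ lp].
  by rewrite tau_sface // -ltnS (leq_trans lp).
rewrite /= !tau_sum // 1?ltnW //.
rewrite [X in X + _ = _]big_nat_recr ?leqW //= sface_last -addrA.
by congr (_ + _); rewrite [RHS]big_nat_recl // big_add1.
Qed.

(** Summed over i, [iter_tau_bop] gives for each face l the powers [tau ^ i] with
    i <= l from its first part and those with i > l from its second part, hence
    every power once. *)
Lemma bop'_Nop m (x : C m.+1) : bop' (Nop x) = Nop (bop x).
Proof.
pose t i := iter i (@tau k C m.+1) x.
have -> : Nop (bop x) = \sum_(0 <= i < m.+1)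
    (\sum_(i <= l < m.+1) sface l (t i) + \sum_(0 <= l < i.+1) sface l (t i.+1)).
  rewrite big_mkord; apply: eq_bigr => i _.
  by rewrite iter_tau_bop // -ltnS.
have -> : bop' (Nop x) = \sum_(0 <= i < m.+2)
    (\sum_(0 <= l < i) sface l (t i) + \sum_(i <= l < m.+1) sface l (t i)).
  rewrite /Nop linear_sum -(big_mkord predT (fun i => bop' (t i))).
  apply: eq_big_nat => i /andP[_ im].
  by rewrite -big_cat_nat // big_mkord.
rewrite !big_split /= addrC; congr (_ + _).
  by rewrite big_nat_recr //= [X in _ + X]big_geq // addr0.
by rewrite big_nat_recl // big_geq // add0r.
Qed.

Lemma sface_sface m i j (x : C m.+2) : (i < j <= m.+2)%N ->
  sface i (sface j x) = - sface j.-1 (sface i x).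
Proof.
move=> ij; rewrite /sface [X in _ *: X = _]linearZ_LR [X in - (_ *: X)]linearZ_LR /=.
rewrite pc_dd //.
rewrite !scalerA -!exprD -scaleNr.
congr (_ *: _); case: j ij => // j _ /=.
by rewrite addnS exprS mulN1r addnC.
Qed.

(** Induction on n: by [sface_sface] the terms that the face n adds on the left
    cancel those that the face n + 1 adds on the right.  Both [b b = 0] (n = m + 2)
    and [b' b' = 0] (n = m + 1) are instances. *)
Lemma sface_square m n (x : C m.+2) : (n <= m.+2)%N ->
  \sum_(j < n) sface j (\sum_(i < n.+1) sface i x) = 0.
Proof.
elim: n => [|n IH] nm; first by rewrite big_ord0.
rewrite big_ord_recr /=; under eq_bigr do rewrite big_ord_recr linearD /=.
rewrite big_split /= IH 1?ltnW // add0r big_ord_recr linearD /= addrCA addrA.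
rewrite [X in _ + X](sface_sface) ?leqnn //=.
under [X in _ + X + _]eq_bigr => i _.
  rewrite sface_sface ?nm; last by rewrite ltnW // ltnS.
  over.
rewrite sumrN big_ord_recr linearD linear_sum /=.
by rewrite addrAC addrK subrr.
Qed.

Lemma bop_bop m (x : C m.+2) : bop (bop x) = 0.
Proof. exact: sface_square. Qed.

Lemma bop'_bop' m (x : C m.+2) : bop' (bop' x) = 0.
Proof. by apply: (@sface_square m m.+1). Qed.

End Cyclic.

(** * The splitting of a quasi-precyclic module *)

Section QuasiPrecyclic.
Variables (k : pzRingType) (C : para_precyclic k) (HC : quasi_precyclic C).

Lemma piTP m (x : C m) : ker_one_T (piT x) /\ ran_one_T (x - piT x).
Proof.
apply: (xgetPex 0 (P := [set y | ker_one_T y /\ ran_one_T (x - y)])).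
have [y [z [yk zr ->]]] := (HC m).1 x.
by exists y; split=> //; rewrite addrC addKr.
Qed.

Lemma ran_one_T_lin m n (f : {linear C m -> C n}) (x : C m) :
  (forall y, f (bigT y) = bigT (f y)) -> ran_one_T x -> ran_one_T (f x).
Proof. by move=> fT [y ->]; exists (f y); rewrite linearB fT. Qed.

Lemma ran_one_T_comb m a (x y : C m) :
  ran_one_T x -> ran_one_T y -> ran_one_T (a *: x + y).
Proof.
move=> [x' ->] [y' ->]; exists (a *: x' + y').
exact: esym (one_T_linear a x' y').
Qed.

Lemma ran_one_TB m (x y : C m) :
  ran_one_T x -> ran_one_T y -> ran_one_T (x - y).
Proof. by move=> xr yr; rewrite addrC -scaleN1r; apply: ran_one_T_comb. Qed.

Lemma inv_one_TP m (y : C m) : ran_one_T y ->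
  ran_one_T (inv_one_T y) /\ one_T (inv_one_T y) = y.
Proof.
move=> [w yw]; apply: (xgetPex 0 (P := [set z | ran_one_T z /\ z - bigT z = y])).
have [a [z [ak zr wE]]] := (HC m).1 w.
exists z; split=> //; rewrite yw wE linearD /= ak opprD addrACA subrr add0r.
by [].
Qed.

(** The operator x |-> (1 - T)^-1 (x - x^T).  The splitting is an argument so that
    linearity, which depends on it, can be attached to the operator itself. *)
Definition invT (_ : quasi_precyclic C) m (x : C m) : C m := inv_one_T (x - piT x).

Lemma invT_ran m (x : C m) : ran_one_T (invT HC x).
Proof. by have [_ /inv_one_TP[]] := piTP x. Qed.

Lemma piTE m (x : C m) : piT x = x - one_T (invT HC x).
Proof. by have [_ /inv_one_TP[_ ->]] := piTP x; rewrite subKr. Qed.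

(** If z is another candidate, then (1 - T) (z - invT x) is both in the range and in
    the kernel of 1 - T, hence zero; then z - invT x is in both as well. *)
Lemma invT_unique m (x z : C m) :
  ran_one_T z -> one_T (x - one_T z) = 0 -> invT HC x = z.
Proof.
move=> zr xz; apply/eqP; rewrite eq_sym -subr_eq0; apply/eqP.
apply: (HC m).2; last exact: ran_one_TB zr (invT_ran x).
apply/esym/eqP; rewrite -subr_eq0; apply/eqP.
apply: (HC m).2; last by exists (z - invT HC x).
apply/esym/eqP; rewrite -subr_eq0; apply/eqP.
rewrite -[LHS]/(one_T (one_T (z - invT HC x))).
have [pk _] := piTP x.
rewrite [one_T (z - _)]linearB /=.
have -> : one_T z - one_T (invT HC x) = piT x - (x - one_T z).
  by rewrite piTE (opprB x) [RHS]addrC subrKA.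
by rewrite linearB /= xz subr0 /one_T pk subrr.
Qed.

(** By uniqueness, whatever commutes with [T] commutes with the choices made in
    the splitting. *)
Lemma invT_comm m n (f : {linear C m -> C n}) (x : C m) :
  (forall y, f (bigT y) = bigT (f y)) -> f (invT HC x) = invT HC (f x).
Proof.
move=> fT; have f1 y : f (one_T y) = one_T (f y) by rewrite linearB fT.
apply/esym/invT_unique; first exact: ran_one_T_lin fT (invT_ran x).
by rewrite -f1 -linearB -piTE -f1 /one_T (piTP x).1 subrr linear0.
Qed.

Lemma one_T_piT m (x : C m) : one_T (piT x) = 0.
Proof. by rewrite /one_T (piTP x).1 subrr. Qed.

Lemma invT_linear m : linear (@invT HC m).
Proof.
move=> a x y; apply: invT_unique.
  by apply: ran_one_T_comb; apply: invT_ran.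
have -> : a *: x + y - one_T (a *: invT HC x + invT HC y) =
    a *: piT x + piT y.
  rewrite linearP /= !piTE scalerBr.
  by rewrite (opprD (a *: _)) addrACA.
by rewrite linearP /= !one_T_piT scaler0 addr0.
Qed.

HB.instance Definition _ m :=
  GRing.isLinear.Build k (C m) (C m) *:%R (@invT HC m) (@invT_linear m).

End QuasiPrecyclic.

(** * Averaging over the cyclic operator *)

Section Hat.
Variables (k : pzRingType) (iota : {rmorphism rat -> k}).

(** An inverse of the central element n + 1 is central; this is why [hat] is
    linear over a noncommutative [k]. *)
Lemma iota_inv_comm n (a : k) : GRing.comm a (iota n.+1%:R^-1).
Proof.
set u := iota _.
have n0 : n.+1%:R != 0 :> rat by rewrite Num.Theory.pnatr_eq0.
have un : u * n.+1%:R = 1.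
  by rewrite /u -(rmorph_nat iota) -rmorphM mulVf ?rmorph1.
have nu : n.+1%:R * u = 1.
  by rewrite /u -(rmorph_nat iota) -rmorphM mulfV ?rmorph1.
rewrite /GRing.comm -[LHS]mul1r -un -mulrA [n.+1%:R * _]mulrA.
by rewrite -(commr_nat a) -[a * _ * u]mulrA nu mulr1.
Qed.

Variable C : hunital k.

Lemma hat_linear m : linear (@hat k C iota m).
Proof.
move=> a x y; rewrite /hat scalerDr !scalerA.
by rewrite -iota_inv_comm.
Qed.

HB.instance Definition _ m :=
  GRing.isLinear.Build k (C m) (C m) *:%R (@hat k C iota m) (@hat_linear m).

Lemma hat_comm m (f : {linear C m -> C m}) x : f (hat iota x) = hat iota (f x).
Proof. by rewrite /hat linearZ. Qed.

Lemma hat_mulrn m (x : C m) : hat iota x *+ m.+1 = x.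
Proof.
rewrite /hat scalerMnl -mulr_natr -(rmorph_nat iota) -rmorphM.
rewrite mulVf ?Num.Theory.pnatr_eq0 //.
by rewrite rmorph1 scale1r.
Qed.

Lemma Nhat_linear m : linear (@Nhat k C iota m).
Proof. by move=> a x y; rewrite /Nhat !linearP. Qed.

HB.instance Definition _ m :=
  GRing.isLinear.Build k (C m) (C m) *:%R (@Nhat k C iota m) (@Nhat_linear m).

Lemma Dhat_linear m : linear (@Dhat k C iota m).
Proof.
move=> a x y; rewrite /Dhat scaler_sumr -big_split /=.
by apply: eq_bigr => j _; rewrite !linearP mulrnDl scalerMnr.
Qed.

HB.instance Definition _ m :=
  GRing.isLinear.Build k (C m) (C m) *:%R (@Dhat k C iota m) (@Dhat_linear m).

(** Summation by parts, the source of the coefficients m - j of [Dhat]. *)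
Lemma abel_sum (W : zmodType) n (a : nat -> W) :
  \sum_(j < n.+1) (a j - a j.+1) *+ (n - j) = a 0 *+ n.+1 - \sum_(j < n.+1) a j.
Proof.
elim: n a => [|n IH] a; first by rewrite !big_ord1 subrr.
rewrite big_ord_recl subn0 (IH (fun j => a j.+1)) mulrnBl.
by rewrite subrKA [in RHS]big_ord_recl (mulrS _ n.+1) opprD addrACA subrr add0r.
Qed.

Lemma one_tau_Dhat m (x : C m) : one_tau (Dhat iota x) = x - Nhat iota x.
Proof.
rewrite /Dhat linear_sum -[X in X - _]hat_mulrn.
rewrite -(abel_sum m (fun j => iter j (@tau k C m) (hat iota x))).
by apply: eq_bigr => j _; rewrite raddfMn.
Qed.

Lemma Dhat_comm m (f : {linear C m -> C m}) (x : C m) :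
  (forall y, f (tau y) = tau (f y)) -> f (Dhat iota x) = Dhat iota (f x).
Proof.
move=> ft; rewrite /Dhat linear_sum; apply: eq_bigr => j _.
by rewrite raddfMn -hat_comm; congr (_ *+ _); elim: (j : nat) => //= i <-.
Qed.

Lemma Dhat_one_tau m (x : C m) : Dhat iota (one_tau x) = x - Nhat iota x.
Proof.
rewrite -one_tau_Dhat Dhat_comm // => y.
by rewrite /one_tau linearB.
Qed.

End Hat.

(** * Ungraded operators on the product of all degrees *)

Section Product.
Variables (k : pzRingType) (X : graded k).

(** On the product of all C_q an operator of any degree is an endomorphism, so
    that compositions need no degree bookkeeping. *)
Definition gprod : Type := forall q, X q.

HB.instance Definition _ := gen_eqMixin gprod.
HB.instance Definition _ := gen_choiceMixin gprod.

Lemma gprodP (v w : gprod) : (forall q, v q = w q) -> v = w.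
Proof. exact: functional_extensionality_dep. Qed.

Let add (v w : gprod) : gprod := fun q => v q + w q.
Let opp (v : gprod) : gprod := fun q => - v q.
Let zero : gprod := fun=> 0.
Let scale (a : k) (v : gprod) : gprod := fun q => a *: v q.

Let addA : associative add.
Proof. by move=> u v w; apply: gprodP => q; apply: addrA. Qed.
Let addC : commutative add.
Proof. by move=> v w; apply: gprodP => q; apply: addrC. Qed.
Let add0 : left_id zero add.
Proof. by move=> v; apply: gprodP => q; apply: add0r. Qed.
Let addN : left_inverse zero opp add.
Proof. by move=> v; apply: gprodP => q; apply: addNr. Qed.

HB.instance Definition _ :=
  GRing.isZmodule.Build gprod addA addC add0 addN.

Let scaleA a b v : scale a (scale b v) = scale (a * b) v.
Proof. by apply: gprodP => q; apply: scalerA. Qed.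
Let scale1 : left_id 1 scale.
Proof. by move=> v; apply: gprodP => q; apply: scale1r. Qed.
Let scaleDr : right_distributive scale +%R.
Proof. by move=> a v w; apply: gprodP => q; apply: scalerDr. Qed.
Let scaleDl v : {morph scale^~ v : a b / a + b}.
Proof. by move=> a b; apply: gprodP => q; apply: scalerDl. Qed.

HB.instance Definition _ := GRing.Zmodule_isLmodule.Build k gprod
  scaleA scale1 scaleDr scaleDl.

Lemma gprodDE (v w : gprod) q : (v + w) q = v q + w q. Proof. by []. Qed.

Definition level_op (f : forall m, {linear X m -> X m}) (v : gprod) : gprod :=
  fun q => f q (v q).
Definition down_op (f : forall m, {linear X m.+1 -> X m}) (v : gprod) : gprod :=
  fun q => f q (v q.+1).

(** The component of degree 0 is zero because C_(-1) = 0. *)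
Definition up_op (f : forall m, {linear X m -> X m.+1}) (v : gprod) : gprod :=
  fun q => if q is q'.+1 then f q' (v q') else 0.

Lemma level_op_linear f : linear (level_op f).
Proof. by move=> a v w; apply: gprodP => q; apply: linearP. Qed.

HB.instance Definition _ f :=
  GRing.isLinear.Build k gprod gprod *:%R (level_op f) (level_op_linear f).

Lemma down_op_linear f : linear (down_op f).
Proof. by move=> a v w; apply: gprodP => q; apply: linearP. Qed.

HB.instance Definition _ f :=
  GRing.isLinear.Build k gprod gprod *:%R (down_op f) (down_op_linear f).

Lemma up_op_linear f : linear (up_op f).
Proof.
move=> a v w; apply: gprodP => -[|q]; last exact: linearP.
by rewrite gprodDE /= addr0; exact: esym (scaler0 _ _).
Qed.

HB.instance Definition _ f :=
  GRing.isLinear.Build k gprod gprod *:%R (up_op f) (up_op_linear f).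

Lemma regrade_linear q r : linear (@regrade k X q r).
Proof.
move=> a x y; rewrite /regrade; case: eqVneq => [qr|_].
  by case: r / qr.
by rewrite scaler0 addr0.
Qed.

HB.instance Definition _ q r :=
  GRing.isLinear.Build k (X q) (X r) *:%R (@regrade k X q r) (@regrade_linear q r).

Lemma regrade_neq q r (x : X q) : q != r -> regrade r x = 0.
Proof. by rewrite /regrade; case: eqVneq. Qed.

(** The homogeneous element x of degree q, all of whose other components vanish. *)
Definition inc q (x : X q) : gprod := fun r => regrade r x.

Lemma inc_linear q : linear (@inc q).
Proof. by move=> a x y; apply: gprodP => r; apply: linearP. Qed.

HB.instance Definition _ q :=
  GRing.isLinear.Build k (X q) gprod *:%R (@inc q) (@inc_linear q).

Lemma inc_id q (x : X q) : inc x q = x. Proof. exact: regrade_id. Qed.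

Lemma level_op_inc f q (x : X q) : level_op f (inc x) = inc (f q x).
Proof.
apply: gprodP => r; rewrite /level_op /inc.
have [<-|qr] := eqVneq q r; first by rewrite !regrade_id.
by rewrite !regrade_neq // linear0.
Qed.

Lemma up_op_inc f q (x : X q) : up_op f (inc x) = inc (f q x).
Proof.
apply: gprodP => -[|r]; rewrite /up_op /inc; first by rewrite regrade_neq.
have [<-|qr] := eqVneq q r; first by rewrite !regrade_id.
by rewrite !regrade_neq // linear0.
Qed.

Lemma down_op_inc f q (x : X q) : down_op f (inc x) = inc (dn (fun m => f m) x).
Proof.
apply: gprodP => r; rewrite /down_op /inc; case: q x => [|q] x /=.
  by rewrite regrade_neq // !linear0.
have [<-|qr] := eqVneq q r; first by rewrite !regrade_id.
by rewrite !regrade_neq // linear0.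
Qed.

End Product.

Section Operators.
Variables (k : pzRingType) (iota : {rmorphism rat -> k}) (C : hunital k).
Variable (HC : quasi_precyclic C).
Notation V := (gprod C).

Definition bV : V -> V := down_op (fun m => @bop k C m).
HB.instance Definition _ :=
  GRing.isLinear.Build k V V *:%R bV (down_op_linear (fun m => @bop k C m)).
Definition b'V : V -> V := down_op (fun m => @bop' k C m).
HB.instance Definition _ :=
  GRing.isLinear.Build k V V *:%R b'V (down_op_linear (fun m => @bop' k C m)).
Definition one_tauV : V -> V := level_op (fun m => @one_tau k C m).
HB.instance Definition _ :=
  GRing.isLinear.Build k V V *:%R one_tauV (level_op_linear (fun m => @one_tau k C m)).
Definition NV : V -> V := level_op (fun m => @Nop k C m).
HB.instance Definition _ :=
  GRing.isLinear.Build k V V *:%R NV (level_op_linear (fun m => @Nop k C m)).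
Definition one_TV : V -> V := level_op (fun m => @one_T k C m).
HB.instance Definition _ :=
  GRing.isLinear.Build k V V *:%R one_TV (level_op_linear (fun m => @one_T k C m)).
Definition hatV : V -> V := level_op (fun m => @hat k C iota m).
HB.instance Definition _ :=
  GRing.isLinear.Build k V V *:%R hatV (level_op_linear (fun m => @hat k C iota m)).
Definition NhatV : V -> V := level_op (fun m => @Nhat k C iota m).
HB.instance Definition _ :=
  GRing.isLinear.Build k V V *:%R NhatV (level_op_linear (fun m => @Nhat k C iota m)).
Definition DhatV : V -> V := level_op (fun m => @Dhat k C iota m).
HB.instance Definition _ :=
  GRing.isLinear.Build k V V *:%R DhatV (level_op_linear (fun m => @Dhat k C iota m)).
Definition invTV : V -> V := level_op (fun m => @invT k C HC m).
HB.instance Definition _ :=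
  GRing.isLinear.Build k V V *:%R invTV (level_op_linear (fun m => @invT k C HC m)).
Definition sV : V -> V := up_op (fun m => hu_s C m).
HB.instance Definition _ :=
  GRing.isLinear.Build k V V *:%R sV (up_op_linear (fun m => hu_s C m)).
Definition s'V : V -> V := sV \o b'V \o sV.
HB.instance Definition _ := GRing.Linear.copy s'V (sV \o b'V \o sV).
Definition BV : V -> V := one_tauV \o s'V \o NV.
HB.instance Definition _ := GRing.Linear.copy BV (one_tauV \o s'V \o NV).

Lemma bV_bV v : bV (bV v) = 0.
Proof. by apply: gprodP => q; apply: bop_bop. Qed.

Lemma b'V_b'V v : b'V (b'V v) = 0.
Proof. by apply: gprodP => q; apply: bop'_bop'. Qed.

Lemma bV_one_tauV v : bV (one_tauV v) = one_tauV (b'V v).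
Proof. by apply: gprodP => q; apply: bop_one_tau. Qed.

Lemma b'V_NV v : b'V (NV v) = NV (bV v).
Proof. by apply: gprodP => q; apply: bop'_Nop. Qed.

Lemma NV_one_tauV v : NV (one_tauV v) = one_TV v.
Proof. by apply: gprodP => q; apply: Nop_one_tau. Qed.

Lemma one_tauV_NV v : one_tauV (NV v) = one_TV v.
Proof. by apply: gprodP => q; apply: one_tau_Nop. Qed.

Lemma one_tauV_DhatV v : one_tauV (DhatV v) = v - NhatV v.
Proof. by apply: gprodP => q; apply: one_tau_Dhat. Qed.

Lemma DhatV_one_tauV v : DhatV (one_tauV v) = v - NhatV v.
Proof. by apply: gprodP => q; apply: Dhat_one_tau. Qed.

Lemma NV_hatV v : NV (hatV v) = NhatV v.
Proof. by []. Qed.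

Lemma hatV_NV v : hatV (NV v) = NhatV v.
Proof. by apply: gprodP => q; apply/esym/hat_comm. Qed.

Lemma b'V_sV v : b'V (sV v) + sV (b'V v) = v.
Proof.
apply: gprodP => q; rewrite -[RHS](hu_bs (v q)) gprodDE; congr (_ + _).
by case: q.
Qed.

Lemma b'V_sV_b'V v : b'V (sV (b'V v)) = b'V v.
Proof. by rewrite -[in RHS](b'V_sV v) linearD /= b'V_b'V add0r. Qed.

(** Passing from [s] to s' = s b' s keeps the contraction of b', and by [s'V_s'V]
    makes its square vanish. *)
Lemma b'V_s'V v : b'V (s'V v) + s'V (b'V v) = v.
Proof.
rewrite -[RHS](b'V_sV v); congr (_ + _); first exact: b'V_sV_b'V.
by rewrite /s'V /= b'V_sV_b'V.
Qed.

Lemma s'V_s'V v : s'V (s'V v) = 0.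
Proof.
rewrite /s'V /=.
have -> : sV (b'V (sV v)) = sV v - b'V (sV (sV v)).
  by rewrite -[X in X - _]b'V_sV addrAC subrr add0r.
by rewrite linearB /= linearB /= b'V_sV_b'V subrr linear0.
Qed.

End Operators.

(** * Operators that commute with the whole structure *)

Section Central.
Variables (k : pzRingType) (iota : {rmorphism rat -> k}) (C : hunital k).
Notation V := (gprod C).
Notation b := (@bV k C).
Notation b' := (@b'V k C).
Notation e := (@one_tauV k C).
Notation N := (@NV k C).
Notation s' := (@s'V k C).
Notation s := (@sV k C).
Notation U := (@one_TV k C).
Notation hatv := (@hatV k iota C).
Notation Dv := (@DhatV k iota C).

(** The operators in this class act on the coefficients of series in u and commute
    with every construction made there.  They are [1 - T], the inverse of [1 - T]
    on its range, and the projection onto the kernel. *)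
Record central (F : {linear V -> V}) : Prop := Central {
  central_b v : F (b v) = b (F v);
  central_b' v : F (b' v) = b' (F v);
  central_e v : F (e v) = e (F v);
  central_N v : F (N v) = N (F v);
  central_s v : F (s v) = s (F v);
  central_hat v : F (hatv v) = hatv (F v);
  central_D v : F (Dv v) = Dv (F v)
}.

Lemma central_s' F v : central F -> F (s' v) = s' (F v).
Proof. by move=> cF; rewrite /s'V /= !(central_s cF, central_b' cF). Qed.

Lemma central_B F v : central F -> F (@BV k C v) = @BV k C (F v).
Proof.
by move=> cF; rewrite /BV /= central_e // central_s' // central_N.
Qed.

Lemma central_one_TV : central U.
Proof.
have T m n (f : {linear C m -> C n}) (x : C m) :
  (forall y, f (bigT y) = bigT (f y)) -> one_T (f x) = f (one_T x).
  by move=> fT; rewrite /one_T linearB fT.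
split=> v; apply: gprodP => q.
- by apply: T => x; apply: bop_bigT.
- by apply: T => x; apply: bop'_bigT.
- by apply: T => x; apply: one_tau_bigT.
- by apply: T => x; apply: Nop_bigT.
- by case: q => [|q]; [apply: linear0 | apply: T => x; apply: hu_sT].
- exact: hat_comm.
- apply: Dhat_comm => x; apply: T => y; exact: tau_bigT.
Qed.

Section Quasi.
Variable HC : quasi_precyclic C.
Notation g := (@invTV k C HC).

Lemma central_invTV : central g.
Proof.
split=> v; apply: gprodP => q.
- by apply/esym/invT_comm => x; apply: bop_bigT.
- by apply/esym/invT_comm => x; apply: bop'_bigT.
- by apply/esym/invT_comm => x; apply: one_tau_bigT.
- by apply/esym/invT_comm => x; apply: Nop_bigT.
- case: q => [|q]; first exact: linear0.
  by apply/esym/invT_comm => x; apply: hu_sT.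
- exact: hat_comm.
- apply: Dhat_comm => x; apply/esym/invT_comm => y; exact: tau_bigT.
Qed.

Lemma invTV_one_TV v : g (U v) = U (g v).
Proof.
apply: gprodP => q; apply/esym/invT_comm => x.
by rewrite /one_T linearB.
Qed.

(** The projection [piT], in a form that makes its linearity visible. *)
Definition piV (v : V) : V := v - U (g v).

Lemma piV_linear : linear piV.
Proof. by move=> a v w; rewrite /piV scalerBr [RHS]addrACA -opprD !linearP. Qed.

HB.instance Definition _ :=
  GRing.isLinear.Build k V V *:%R piV piV_linear.

Lemma piVE v : piV v = v - U (g v). Proof. by []. Qed.

Lemma piV_piT v q : piV v q = piT (v q).
Proof. by rewrite (piTE HC). Qed.

Lemma one_TV_piV v : U (piV v) = 0.
Proof.
by apply: gprodP => q; rewrite -[RHS](one_T_piT HC (v q)) -piV_piT.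
Qed.

Lemma piV_one_TV v : piV (U v) = 0.
Proof. by rewrite piVE invTV_one_TV -(linearB U); apply: one_TV_piV. Qed.

Lemma piV_idem v : piV (piV v) = piV v.
Proof. by rewrite [LHS]piVE -invTV_one_TV one_TV_piV linear0 subr0. Qed.

Lemma central_piV : central piV.
Proof.
have cg := central_invTV; have cU := central_one_TV.
split=> v; rewrite /= !piVE.
- by rewrite (central_b cg) (central_b cU) [RHS]linearB.
- by rewrite (central_b' cg) (central_b' cU) [RHS]linearB.
- by rewrite (central_e cg) (central_e cU) [RHS]linearB.
- by rewrite (central_N cg) (central_N cU) [RHS]linearB.
- by rewrite (central_s cg) (central_s cU) [RHS]linearB.
- by rewrite (central_hat cg) (central_hat cU) [RHS]linearB.
- by rewrite (central_D cg) (central_D cU) [RHS]linearB.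
Qed.

End Quasi.
End Central.

(** * The perturbed homotopy on the cyclic bicomplex *)

Section Series.
Variables (k : pzRingType) (iota : {rmorphism rat -> k}) (C : hunital k).
Notation V := (gprod C).
Notation Z := (nat -> V).
Notation b := (@bV k C).
Notation b' := (@b'V k C).
Notation e := (@one_tauV k C).
Notation N := (@NV k C).
Notation hatv := (@hatV k iota C).
Notation Dv := (@DhatV k iota C).
Notation Nh := (@NhatV k iota C).

Lemma serD (z w : Z) n : (z + w) n = z n + w n. Proof. by []. Qed.

Lemma serN (z : Z) n : (- z) n = - z n. Proof. by []. Qed.

Lemma serB (z w : Z) n : (z - w) n = z n - w n. Proof. by []. Qed.

Lemma serZ a (z : Z) n : (a *: z) n = a *: z n. Proof. by []. Qed.

(** [dcol n], [pcol n] and [phicol n] are the vertical differential, the horizontal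
    differential and the row contraction of the cyclic bicomplex at the
    coefficient of u^n. *)
Definition dcol n (v : V) : V := if odd n then - b' v else b v.
Definition pcol n (v : V) : V := if odd n then N v else e v.
Definition phicol n (v : V) : V := if odd n then - hatv v else - Dv v.

Lemma dcol_linear n : linear (dcol n).
Proof.
move=> a v w; rewrite /dcol; case: odd; rewrite linearP //.
by rewrite opprD scalerN.
Qed.

HB.instance Definition _ n :=
  GRing.isLinear.Build k V V *:%R (dcol n) (dcol_linear n).

Lemma pcol_linear n : linear (pcol n).
Proof. by move=> a v w; rewrite /pcol; case: odd; rewrite linearP. Qed.

HB.instance Definition _ n :=
  GRing.isLinear.Build k V V *:%R (pcol n) (pcol_linear n).

Lemma phicol_linear n : linear (phicol n).
Proof.
by move=> a v w; rewrite /phicol; case: odd; rewrite linearP opprD scalerN.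
Qed.

HB.instance Definition _ n :=
  GRing.isLinear.Build k V V *:%R (phicol n) (phicol_linear n).

Definition delta_s (z : Z) : Z := fun n => dcol n (z n).

(** The horizontal differential of the cyclic bicomplex.  Its square is 1 - T shifted
    by two columns. *)
Definition partial_s (z : Z) : Z := fun n => pcol n (z n.+1).
Definition phi_s (z : Z) : Z := fun n => if n is n'.+1 then phicol n' (z n') else 0.

Lemma delta_s_linear : linear delta_s.
Proof. by move=> a z w; apply/funext => n; apply: linearP. Qed.

HB.instance Definition _ :=
  GRing.isLinear.Build k Z Z *:%R delta_s delta_s_linear.

Lemma partial_s_linear : linear partial_s.
Proof. by move=> a z w; apply/funext => n; apply: linearP. Qed.

HB.instance Definition _ :=
  GRing.isLinear.Build k Z Z *:%R partial_s partial_s_linear.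

Lemma phi_s_linear : linear phi_s.
Proof.
move=> a z w; apply/funext => -[|n]; last exact: linearP.
by rewrite serD serZ /= scaler0 addr0.
Qed.

HB.instance Definition _ :=
  GRing.isLinear.Build k Z Z *:%R phi_s phi_s_linear.

Definition Q_s (z : Z) : Z := delta_s z + partial_s z.

Definition mono n (v : V) : Z := fun p => if p == n then v else 0.

Lemma mono_linear n : linear (mono n).
Proof.
move=> a v w; apply/funext => p; rewrite serD serZ /mono.
by case: ifP => // _; rewrite scaler0 addr0.
Qed.

HB.instance Definition _ n :=
  GRing.isLinear.Build k V Z *:%R (mono n) (mono_linear n).

(** The sum of all [(phi delta)^j].  As [phi delta] raises the power of u by one, the
    coefficient of u^(n+1) is determined by that of u^n. *)
Fixpoint R_s (z : Z) n : V :=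
  if n is n'.+1 then z n + phicol n' (dcol n' (R_s z n')) else z n.

Lemma R_sE z : R_s z = z + phi_s (delta_s (R_s z)).
Proof. by apply/funext => -[|n]; rewrite serD //= addr0. Qed.

(** The equation w = z + phi delta w determines w coefficient by coefficient, so
    every identity for [R_s] can be proved by checking this equation. *)
Lemma R_s_unique z w : w = z + phi_s (delta_s w) -> w = R_s z.
Proof.
move=> wE; apply/funext; elim=> [|n IH]; rewrite wE serD /=.
  by rewrite addr0.
by rewrite /delta_s IH.
Qed.

Lemma R_s_linear : linear R_s.
Proof.
move=> a z w; apply/esym/R_s_unique.
rewrite {1}(R_sE z) {1}(R_sE w) linearP /= linearP /=.
by rewrite scalerDr addrACA.
Qed.

HB.instance Definition _ :=
  GRing.isLinear.Build k Z Z *:%R R_s R_s_linear.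

Lemma R_s0 z : R_s z 0 = z 0. Proof. by []. Qed.

Lemma delta_s_sq z : delta_s (delta_s z) = 0.
Proof.
apply/funext => n; rewrite /delta_s /dcol; case: odd; last exact: bV_bV.
by rewrite linearN /= opprK b'V_b'V.
Qed.

Lemma delta_partial z : delta_s (partial_s z) = - partial_s (delta_s z).
Proof.
apply/funext => n; rewrite serN /delta_s /partial_s /dcol /pcol /=.
case: (odd n) => /=; first by rewrite b'V_NV.
by rewrite linearN /= opprK bV_one_tauV.
Qed.

(** The rows are contracted by [phi] onto the image of [Nhat] in column 0: this is
    (1 - tau) Dhat = Dhat (1 - tau) = 1 - Nhat, read in the two parities. *)
Lemma partial_phi z : partial_s (phi_s z) + phi_s (partial_s z) = mono 0 (Nh (z 0)) - z.
Proof.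
apply/funext => -[|n]; rewrite serD serB /partial_s /mono /= /pcol /phicol /=.
  by rewrite linearN /= one_tauV_DhatV opprB addr0.
rewrite sub0r; case: (odd n) => /=.
- rewrite linearN /= one_tauV_DhatV hatV_NV.
  by rewrite opprB addrAC subrr sub0r.
- rewrite linearN /= NV_hatV DhatV_one_tauV.
  by rewrite opprB addKr.
Qed.

(** The homological perturbation lemma.  Both sides satisfy the equation of
    [R_s_unique]; the check uses the row contraction [partial_phi],
    delta delta = 0 and delta partial = - partial delta.  These
    relations hold on all of C, not only on T-invariants, and so does the
    result. *)
Lemma R_phi_homotopy z :
  R_s (mono 0 (Nh (z 0))) =
    z + Q_s (R_s (phi_s z)) + R_s (phi_s (Q_s z)).
Proof.
set P := mono 0 _; apply/esym/R_s_unique.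
set F := R_s (phi_s z); set w := delta_s F.
have dQ : delta_s (Q_s F) = - partial_s w.
  by rewrite /Q_s linearD /= delta_s_sq add0r delta_partial.
have w0 : w 0 = 0 by rewrite /w /delta_s /F R_s0 /= linear0.
have phi_w : phi_s w = F - phi_s z.
  by rewrite [in RHS]/F R_sE addrAC subrr add0r.
have phi_dQ : phi_s (delta_s (Q_s F)) = partial_s F - partial_s (phi_s z) + w.
  have pw : phi_s (partial_s w) = - w - partial_s (phi_s w).
    apply: (addrI (partial_s (phi_s w))).
    by rewrite partial_phi w0 !linear0 sub0r addrC subrK.
  by rewrite dQ linearN /= pw opprB opprK phi_w linearB.
pose y := phi_s (Q_s z).
have -> : P = partial_s (phi_s z) + phi_s (partial_s z) + z.
  by rewrite partial_phi subrK.
have pd x1 x2 : phi_s (delta_s (x1 + x2)) = phi_s (delta_s x1) + phi_s (delta_s x2).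
  by rewrite linearD /= linearD.
rewrite pd (pd z) phi_dQ.
have -> : phi_s (delta_s (R_s y)) = R_s y - (phi_s (delta_s z) + phi_s (partial_s z)).
  by rewrite -(linearD phi_s) [in RHS]R_sE addrAC subrr add0r.
rewrite {1}/Q_s -/w.
move: (R_s _) => r; move: (partial_s F) => p.
move: (partial_s (phi_s z)) (phi_s (partial_s z)) (phi_s (delta_s z)) => u v a.
(* What remains is a rearrangement of terms in an abelian group. *)
rewrite (opprD a v) [r + _]addrCA [a + _]addrC -[_ + a + _]addrA addNKr.
rewrite (addrA (u + v + z)).
have -> : u + v + z + (p - u + w) = v + (z + (w + p)).
  rewrite [p - u + w]addrAC -[u + v + z]addrA [p + w - u]addrC addrACA subrr.
  by rewrite add0r -addrA [p + w]addrC.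
by rewrite [r - v]addrC addrACA subrr add0r.
Qed.

End Series.

(** * Transfer to the mixed complex and T-invariant part *)

Section Mixed.
Variables (k : pzRingType) (iota : {rmorphism rat -> k}) (C : hunital k).
Notation V := (gprod C).
Notation Z := (nat -> V).
Notation b := (@bV k C).
Notation b' := (@b'V k C).
Notation e := (@one_tauV k C).
Notation N := (@NV k C).
Notation s' := (@s'V k C).
Notation U := (@one_TV k C).
Notation B := (@BV k C).
Notation hatv := (@hatV k iota C).
Notation Dv := (@DhatV k iota C).
Notation Nh := (@NhatV k iota C).
Notation phi_s := (@phi_s k iota C).
Notation R_s := (@R_s k iota C).
Notation Q_s := (@Q_s k C).

(** The operator b + B u^-1. *)
Definition bB_s (z : Z) : Z := fun p => b (z p) + B (z p.+1).
Definition I_s (z : Z) : Z := fun n => if odd n then s' (N (z n./2.+1)) else z n./2.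
Definition J_s (z : Z) : Z := fun p => z p.*2 + e (s' (z p.*2.+1)).

Lemma bB_s_linear : linear bB_s.
Proof.
move=> a z w; apply/funext => p; rewrite serD serZ /bB_s !serD !serZ !linearP /=.
by rewrite addrACA -scalerDr.
Qed.

HB.instance Definition _ :=
  GRing.isLinear.Build k Z Z *:%R bB_s bB_s_linear.

Lemma I_s_linear : linear I_s.
Proof.
move=> a z w; apply/funext => n; rewrite serD serZ /I_s !serD !serZ.
by case: odd => //; rewrite !linearP.
Qed.

HB.instance Definition _ :=
  GRing.isLinear.Build k Z Z *:%R I_s I_s_linear.

Lemma J_s_linear : linear J_s.
Proof.
move=> a z w; apply/funext => p; rewrite serD serZ /J_s !serD !serZ !linearP /=.
by rewrite addrACA -scalerDr.
Qed.

HB.instance Definition _ :=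
  GRing.isLinear.Build k Z Z *:%R J_s J_s_linear.

Lemma one_TV_s'V v : U (s' v) = s' (U v).
Proof. exact: central_s' (central_one_TV iota C). Qed.

Lemma s'NB_eq0 v : s' (N (B v)) = 0.
Proof. by rewrite /BV /= NV_one_tauV one_TV_s'V s'V_s'V. Qed.

(** On odd coefficients this is N - b's'N = s'b'N = s'Nb; the term s'NB vanishes
    because s's' = 0. *)
Lemma I_s_chain z : I_s (bB_s z) = Q_s (I_s z).
Proof.
apply/funext => n.
rewrite /Q_s serD /delta_s /partial_s /I_s /bB_s /dcol /pcol /= uphalf_half.
case: (odd n) => /=; rewrite ?add1n ?add0n //.
rewrite linearD /= [s' _]linearD /= s'NB_eq0 addr0 -b'V_NV.
by rewrite -[X in _ = _ + X](b'V_s'V (N _)) addKr.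
Qed.

(** An odd coefficient contributes b (1 - tau) s' = (1 - tau) (1 - s'b') to both sides,
    since B (1 - tau) s' = 0 by s's' = 0. *)
Lemma J_s_chain z : bB_s (J_s z) = J_s (Q_s z).
Proof.
apply/funext => p; pose y := z p.*2.+1.
have BeS v : B (e (s' v)) = 0.
  by rewrite /BV /= NV_one_tauV -one_TV_s'V s'V_s'V !linear0.
have -> : bB_s (J_s z) p = b (z p.*2) + b (e (s' y)) + B (z p.*2.+2).
  by rewrite /bB_s /J_s doubleS linearD [B _]linearD /= BeS addr0 addrA.
have -> : J_s (Q_s z) p =
    b (z p.*2) + e y + e (s' (- b' y + N (z p.*2.+2))).
  by rewrite /J_s /Q_s /delta_s /partial_s !serD /dcol /pcol /= odd_double.
have -> : b (e (s' y)) = e y - e (s' (b' y)).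
  by rewrite bV_one_tauV -linearB; congr (e _); rewrite -[X in X - _](b'V_s'V y) addrK.
rewrite (linearD s') (linearD e) (linearN s') (linearN e) /=.
by rewrite [b _ + (_ - _)]addrA -[LHS]addrA.
Qed.

Lemma J_sI_s z : J_s (I_s z) = z.
Proof.
apply/funext => p; rewrite /J_s /I_s /= odd_double /= doubleK.
by rewrite s'V_s'V linear0 addr0.
Qed.

Lemma bV_BV v : b (B v) + B (b v) = U v.
Proof. by rewrite /BV /= bV_one_tauV -b'V_NV -linearD b'V_s'V; apply: one_tauV_NV. Qed.

Lemma BV_BV v : B (B v) = 0.
Proof. by rewrite {1}/BV /= s'NB_eq0 linear0. Qed.

Lemma bB_s_sq z p : bB_s (bB_s z) p = U (z p.+1).
Proof.
by rewrite /bB_s linearD [B (_ + _)]linearD /= bV_bV BV_BV add0r addr0 bV_BV.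
Qed.

Definition phi_n_s (z : Z) : Z := J_s (R_s (phi_s (I_s z))).
HB.instance Definition _ := GRing.Linear.copy phi_n_s (J_s \o R_s \o phi_s \o I_s).
Definition nu0_s (v : V) : Z := J_s (R_s (mono 0 (Nh v))).
HB.instance Definition _ := GRing.Linear.copy nu0_s (J_s \o R_s \o @mono k C 0 \o Nh).

(** Conjugating [R_phi_homotopy] by the chain maps [I_s] and [J_s], with J I = 1. *)
Lemma nu0_homotopy z : nu0_s (z 0) = z + bB_s (phi_n_s z) + phi_n_s (bB_s z).
Proof.
rewrite /phi_n_s I_s_chain J_s_chain -[X in X + _ + _]J_sI_s -!linearD /=.
by rewrite /nu0_s; congr (J_s _); apply: R_phi_homotopy.
Qed.

Definition lift_s (F : V -> V) (z : Z) : Z := fun p => F (z p).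

Lemma lift_s_linear (F : {linear V -> V}) : linear (lift_s F).
Proof. by move=> a z w; apply/funext => p; apply: linearP. Qed.

HB.instance Definition _ (F : {linear V -> V}) :=
  GRing.isLinear.Build k Z Z *:%R (lift_s F) (lift_s_linear F).

Section LiftCentral.
Variables (F : {linear V -> V}) (cF : central iota F).

Lemma lift_bB_s z : lift_s F (bB_s z) = bB_s (lift_s F z).
Proof.
apply/funext => p; rewrite /lift_s /bB_s linearD (central_b cF).
by rewrite (central_B _ cF).
Qed.

Lemma lift_J_s z : lift_s F (J_s z) = J_s (lift_s F z).
Proof.
apply/funext => n; rewrite /lift_s /J_s linearD.
by rewrite (central_e cF) (central_s' _ cF).
Qed.

Lemma lift_phi_s z : lift_s F (phi_s z) = phi_s (lift_s F z).
Proof.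
apply/funext => -[|n]; rewrite /lift_s /=; first exact: linear0.
rewrite /phicol; case: odd; rewrite linearN.
  by rewrite (central_hat cF).
by rewrite (central_D cF).
Qed.

Lemma lift_delta_s z : lift_s F (delta_s z) = delta_s (lift_s F z).
Proof.
apply/funext => n; rewrite /lift_s /delta_s /dcol; case: odd.
  by rewrite linearN (central_b' cF).
by rewrite (central_b cF).
Qed.

(** Uniqueness in [R_s_unique] makes any operator that commutes with [phi] and
    [delta] commute with the series [R_s]. *)
Lemma lift_R_s z : lift_s F (R_s z) = R_s (lift_s F z).
Proof.
apply/R_s_unique; rewrite -lift_delta_s -lift_phi_s -linearD.
by rewrite -R_sE.
Qed.

Lemma lift_mono n v : lift_s F (mono n v) = mono n (F v).
Proof.
by apply/funext => p; rewrite /lift_s /mono; case: ifP => // _; apply: linear0.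
Qed.

Lemma lift_nu0_s v : lift_s F (nu0_s v) = nu0_s (F v).
Proof.
by rewrite /nu0_s lift_J_s lift_R_s lift_mono -!NV_hatV (central_N cF) (central_hat cF).
Qed.

End LiftCentral.

Section Quasi.
Variable HC : quasi_precyclic C.
Notation g := (@invTV k C HC).
Notation piv := (@piV k C HC).

Definition nuT_s (v : V) : Z := lift_s piv (nu0_s v).
HB.instance Definition _ := GRing.Linear.copy nuT_s (lift_s piv \o nu0_s).
Definition h_s (z : Z) : Z := fun p => - B (g (z p)).

Lemma h_s_linear : linear h_s.
Proof. by move=> a z w; apply/funext => p; rewrite /h_s serD serZ !linearP. Qed.

HB.instance Definition _ :=
  GRing.isLinear.Build k Z Z *:%R h_s h_s_linear.
Definition phiT_s (z : Z) : Z := h_s z + phi_n_s (lift_s piv z).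

Lemma phiT_s_linear : linear phiT_s.
Proof. by move=> a z w; rewrite /phiT_s !linearP scalerDr addrACA. Qed.

HB.instance Definition _ :=
  GRing.isLinear.Build k Z Z *:%R phiT_s phiT_s_linear.

Let cg := central_invTV iota HC.
Let cpi := central_piV iota HC.

(** As bB + Bb = 1 - T and BB = 0, the operator -B (1 - T)^-1 contracts the range of
    1 - T. *)
Lemma h_s_homotopy z : z + bB_s (h_s z) + h_s (bB_s z) = lift_s piv z.
Proof.
apply/funext => p; rewrite /lift_s piVE -addrA !serD; congr (_ + _).
rewrite /bB_s /h_s (linearD g) (linearD B) (linearN b) (linearN B) /=.
by rewrite (central_B _ cg) (central_b cg) !BV_BV oppr0 !addr0 -opprD bV_BV.
Qed.

(** The contraction [h_s] deforms the identity to the projection on T-invariants,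
    where [nu0_homotopy] takes over. *)
Lemma nuT_homotopy z : nuT_s (z 0) = z + bB_s (phiT_s z) + phiT_s (bB_s z).
Proof.
have -> : nuT_s (z 0) = nu0_s (lift_s piv z 0) by apply: (lift_nu0_s cpi).
rewrite nu0_homotopy -(lift_bB_s cpi) -{1}h_s_homotopy.
rewrite /phiT_s [bB_s (_ + phi_n_s _)]linearD /=.
move: (bB_s (h_s z)) (h_s (bB_s z)) (bB_s (phi_n_s (lift_s piv z))) => x y u.
move: (phi_n_s (lift_s piv (bB_s z))) => v.
by rewrite [RHS]addrA [z + (x + u)]addrA [z + x + u + y]addrAC.
Qed.

(** The homotopy formula gives the commutator of D = b + B u^-1 with the
    retraction as D^2 Phi - Phi D^2.  Since D^2 = (1 - T) u^-1, this
    commutator is killed by the projection onto T-invariants, which fixes the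
    retraction. *)
Lemma nuT_chain z : bB_s (nuT_s (z 0)) = nuT_s (bB_s z 0).
Proof.
have piK v : lift_s piv (nuT_s v) = nuT_s v.
  by apply/funext => p; apply: piV_idem.
have MM y : bB_s (bB_s y) = lift_s U (fun p => y p.+1).
  by apply/funext => p; apply: bB_s_sq.
have piU y : lift_s piv (lift_s U y) = 0 by apply/funext => p; apply: piV_one_TV.
have piPhiU y : lift_s piv (phiT_s (lift_s U y)) = 0.
  rewrite /phiT_s piU linear0 addr0; apply/funext => p.
  rewrite /lift_s /h_s linearN (central_B _ cpi) invTV_one_TV /= piV_one_TV.
  by rewrite linear0 oppr0.
have key : bB_s (nuT_s (z 0)) = nuT_s (bB_s z 0) +
    (bB_s (bB_s (phiT_s z)) - phiT_s (bB_s (bB_s z))).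
  have MD (x y w : Z) : bB_s (x + y + w) = bB_s x + bB_s y + bB_s w.
    by rewrite linearD /=; congr (_ + _); apply: linearD.
  rewrite !nuT_homotopy MD.
  move: (bB_s (phiT_s (bB_s z))) (bB_s (bB_s (phiT_s z))) => x y.
  move: (phiT_s (bB_s (bB_s z))) (bB_s z) => u w.
  by rewrite [RHS]addrACA subrr addr0 addrAC.
have piD (x y w : Z) :
    lift_s piv (x + (y - w)) = lift_s piv x + (lift_s piv y - lift_s piv w).
  by rewrite linearD linearB.
have <- : lift_s piv (bB_s (nuT_s (z 0))) = bB_s (nuT_s (z 0)).
  by apply: etrans (lift_bB_s cpi _) _; congr (bB_s _); apply: piK.
rewrite key piD !MM piU piPhiU subrr addr0; exact: piK.
Qed.

(** N (1 - tau) = 1 - T, which the projection onto T-invariants kills. *)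
Lemma nuT_s_one_tau v : nuT_s (e v) = 0.
Proof.
have -> : nuT_s (e v) = lift_s piv (nu0_s (e v)) by [].
have -> : nu0_s (e v) = lift_s U (J_s (R_s (mono 0 (hatv v)))).
  rewrite (lift_J_s (central_one_TV iota C)) (lift_R_s (central_one_TV iota C)).
  rewrite lift_mono /nu0_s -hatV_NV NV_one_tauV.
  by rewrite (central_hat (central_one_TV iota C)).
by apply/funext => p; apply: piV_one_TV.
Qed.

(** Modulo the range of 1 - tau, both [Nhat] and [piT] are the identity, and
    [J_s] adds to the coefficient of u^0 only elements of that range. *)
Lemma nuT_s_coef0 v : exists w, nuT_s v 0 = v + e w.
Proof.
pose y := s' (R_s (mono 0 (Nh v)) 1).
exists (piv (y - Dv v) - N (g v)).
have -> : nuT_s v 0 = piv (v + e (y - Dv v)).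
  rewrite linearB /= one_tauV_DhatV opprB addrCA [v + _]addrC subrK addrC.
  by [].
rewrite linearD (central_e cpi) (linearB e (piv (y - Dv v))) /= one_tauV_NV piVE.
by rewrite -addrA [- _ + _]addrC.
Qed.

(** The series [R_s (phi_s _)] has no u^0 term, and B has values in the range of
    1 - tau. *)
Lemma phiT_s_coef0 z : exists w, phiT_s z 0 = e w.
Proof.
exists (s' (R_s (phi_s (I_s (lift_s piv z))) 1) - s' (N (g (z 0)))).
rewrite linearB addrC /phiT_s serD; congr (_ + _).
exact: add0r.
Qed.

End Quasi.
End Mixed.

(** * Graded polynomials as series *)

Section Embedding.
Variables (k : pzRingType) (C : hunital k).
Notation V := (gprod C).
Notation Z := (nat -> V).

Lemma ulift_linear e m (W : lmodType k) (f : forall p q, C q -> W) :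
  (forall p q, linear (f p q)) -> linear (@ulift k e C m W f).
Proof.
move=> lf a x y; rewrite /ulift scaler_sumr -big_split /=.
by apply: eq_bigr => i _; rewrite linearP lf.
Qed.

(** A graded polynomial of degree m, seen as a series in u with coefficients in
    the product of all degrees. *)
Definition emb e m (z : upoly e C m) : Z :=
  ulift (fun p q (x : C q) => mono p (inc x)) z.

Lemma emb_linear e m : linear (@emb e m).
Proof. by apply: ulift_linear => p q a x y; rewrite !linearP. Qed.

HB.instance Definition _ e m :=
  GRing.isLinear.Build k (upoly e C m) Z *:%R (@emb e m) (@emb_linear e m).

Lemma emb_nth e m (z : upoly e C m) (i : 'I_(m %/ e).+1) :
  emb z i (m - e * i)%N = dsum_nth i z.
Proof.
rewrite /emb /ulift fct_sumE (bigD1 i) //= big1 ?addr0.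
  by rewrite /mono eqxx inc_id.
by move=> j ji; rewrite /mono ifN // eq_sym.
Qed.

Lemma emb_inj e m : injective (@emb e m).
Proof. by move=> z w zw; apply/dsumP => i; rewrite -!emb_nth zw. Qed.

Lemma emb_umon e m p q (x : C q) : (0 < e)%N -> m = (e * p + q)%N ->
  emb (x *u^ p : upoly e C m) = mono p (inc x).
Proof.
by move=> e0 mE; rewrite /emb ulift_umon // => p' q'; rewrite !linear0.
Qed.

Lemma emb_umon0 e m p q : emb ((0 : C q) *u^ p : upoly e C m) = 0.
Proof.
suff -> : (0 : C q) *u^ p = 0 :> upoly e C m by rewrite linear0.
by apply/dsumP => i; rewrite dsum_ofE !linear0; case: ifP.
Qed.

(** Every comparison of a graded with an ungraded operator reduces to monomials,
    because both are additive. *)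
Lemma emb_ulift e m e' m' (f : forall p q, C q -> upoly e' C m')
    (F : {linear Z -> Z}) (z : upoly e C m) : (0 < e)%N ->
  (forall p q (x : C q), m = (e * p + q)%N -> emb (f p q x) = F (mono p (inc x))) ->
  emb (ulift f z) = F (emb z).
Proof.
move=> e0 fF; rewrite [in RHS]/emb /ulift !linear_sum; apply: eq_bigr => i _.
apply: fF; rewrite subnKC // mulnC -leq_divRL //.
by rewrite -ltnS.
Qed.

Lemma emb_vanish e m (F : {linear Z -> Z}) (z : upoly e C m) : (0 < e)%N ->
  (forall p q (x : C q), m = (e * p + q)%N -> F (mono p (inc x)) = 0) ->
  F (emb z) = 0.
Proof.
move=> e0 F0; rewrite -(@emb_ulift e m e m (fun _ _ _ => 0)) //.
  by rewrite /ulift big1 ?linear0.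
by move=> p q x mE; rewrite F0 // linear0.
Qed.

(** Recovers the graded coefficient of u^0 from the ungraded one, which is supported
    in degree m. *)
Lemma emb_degree e m (z : upoly e C m) : (0 < e)%N -> emb z 0 = inc (emb z 0 m).
Proof.
move=> e0; rewrite /emb /ulift fct_sumE.
have -> : (\sum_(i < (m %/ e).+1) mono i (inc (dsum_nth i z)) 0 : V) m =
    \sum_(i < (m %/ e).+1) mono i (inc (dsum_nth i z)) 0 m.
  by apply: (big_morph (fun v : V => v m)).
rewrite linear_sum /=; apply: eq_bigr => -[i im] _ /=; rewrite /mono.
case: eqVneq => [i0|_]; last by apply/esym; apply: linear0.
move: (dsum_nth _ _) => /=; rewrite -i0 muln0 subn0 => x.
by rewrite inc_id.
Qed.

End Embedding.

(** * The graded operators in terms of the ungraded ones *)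

Section Transport.
Variables (k : pzRingType) (iota : {rmorphism rat -> k}) (C : hunital k).
Notation V := (gprod C).
Notation Z := (nat -> V).

Lemma bV_inc q (x : C q) : bV (inc x) = inc (dn (@bop k C) x).
Proof. exact: (down_op_inc (fun m => @bop k C m)). Qed.

Lemma b'V_inc q (x : C q) : b'V (inc x) = inc (dn (@bop' k C) x).
Proof. exact: (down_op_inc (fun m => @bop' k C m)). Qed.

Lemma one_tauV_inc q (x : C q) : one_tauV (inc x) = inc (one_tau x).
Proof. exact: (level_op_inc (fun m => @one_tau k C m)). Qed.

Lemma NV_inc q (x : C q) : NV (inc x) = inc (Nop x).
Proof. exact: (level_op_inc (fun m => @Nop k C m)). Qed.

Lemma hatV_inc q (x : C q) : hatV iota (inc x) = inc (hat iota x).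
Proof. exact: (level_op_inc (fun m => @hat k C iota m)). Qed.

Lemma DhatV_inc q (x : C q) : DhatV iota (inc x) = inc (Dhat iota x).
Proof. exact: (level_op_inc (fun m => @Dhat k C iota m)). Qed.

Lemma NhatV_inc q (x : C q) : NhatV iota (inc x) = inc (Nhat iota x).
Proof. exact: (level_op_inc (fun m => @Nhat k C iota m)). Qed.

Lemma sV_inc q (x : C q) : sV (inc x) = inc (hu_s C q x).
Proof. exact: (up_op_inc (fun m => hu_s C m)). Qed.

Lemma s'V_inc q (x : C q) : s'V (inc x) = inc (sop' x).
Proof. by rewrite /s'V /= sV_inc b'V_inc sV_inc. Qed.

Lemma BV_inc q (x : C q) : BV (inc x) = inc (Bop x).
Proof. by rewrite /BV /= NV_inc s'V_inc one_tauV_inc. Qed.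

(** In degree q = 0 the coefficient y would lie in C_(-1), which the truncated
    predecessor replaces by C_0; there it has to vanish. *)
Lemma emb_umon_pred e m p q (y : C q.-1) :
  (0 < e)%N -> m.+1 = (e * p + q)%N -> (q = 0%N -> y = 0) ->
  emb (y *u^ p : upoly e C m) = mono p (inc y).
Proof.
case: q y => [|q] y e0 mE y0 /=; first by rewrite y0 // emb_umon0 !linear0.
by apply: emb_umon => //; move: mE; rewrite addnS => -[].
Qed.

Lemma dn0 (f : forall m, C m.+1 -> C m) q (x : C q) : q = 0%N -> dn f x = 0.
Proof. by case: q x. Qed.

Lemma bB_s_mono p v : @bB_s k C (mono p v) =
  mono p (bV v) + (if p is p'.+1 then mono p' (BV v) else 0).
Proof.
case: p => [|p]; first rewrite addr0; apply/funext => n; rewrite /bB_s.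
  by rewrite /mono linear0 addr0; case: eqP => // _; rewrite linear0.
rewrite serD /mono eqSS.
by case: (n == p.+1); case: (n == p); rewrite ?linear0.
Qed.

Lemma delta_s_mono n v : @delta_s k C (mono n v) = mono n (dcol n v).
Proof.
apply/funext => p; rewrite /delta_s /mono.
by case: eqP => [->|_] //; rewrite linear0.
Qed.

Lemma phi_s_mono n v : @phi_s k iota C (mono n v) = mono n.+1 (phicol iota n v).
Proof.
apply/funext => -[|p] //; rewrite /= /mono eqSS.
by case: eqP => [->|_] //; rewrite linear0.
Qed.

Lemma I_s_mono p v : @I_s k C (mono p v) =
  mono p.*2 v + (if p is p'.+1 then mono p'.*2.+1 (s'V (NV v)) else 0).
Proof.
have half_eq n r : (n./2 == r) = if odd n then n == r.*2.+1 else n == r.*2.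
  by have := odd_double_half n; case: (odd n) => nE; apply/eqP/eqP; lia.
have even_neq n r : odd n -> n == r.*2 = false.
  by apply: contraTF => /eqP->; rewrite odd_double.
have odd_neq n r : ~~ odd n -> n == r.*2.+1 = false.
  by apply: contraNF => /eqP->; rewrite /= odd_double.
case: p => [|p]; first rewrite addr0; apply/funext => n; rewrite ?serD /I_s /mono.
  by case: ifP => on; [rewrite (even_neq n 0) //= !linear0 | rewrite half_eq on].
case: ifP => on.
  by rewrite even_neq // add0r eqSS half_eq on; case: ifP; rewrite ?linear0.
by rewrite (odd_neq n) ?on // addr0 half_eq on.
Qed.

Lemma J_s_mono n v : @J_s k C (mono n v) =
  mono n./2 (if odd n then one_tauV (s'V v) else v).
Proof.
apply/funext => p; rewrite /J_s /mono.
have := odd_double_half n; case: (odd n) => nE.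
  have -> : (p.*2 == n) = false by apply/eqP; lia.
  have -> : (p.*2.+1 == n) = (p == n./2) by apply/eqP/eqP; lia.
  by rewrite add0r; case: eqP; rewrite ?linear0.
have -> : (p.*2.+1 == n) = false by apply/eqP; lia.
have -> : (p.*2 == n) = (p == n./2) by apply/eqP/eqP; lia.
by rewrite !linear0 addr0.
Qed.

Lemma emb_bB m (z : Cn C m.+1) : emb (bB z) = @bB_s k C (emb z).
Proof.
apply: emb_ulift => // p q x mE; rewrite linearD /= bB_s_mono bV_inc BV_inc.
rewrite (emb_umon_pred (q := q)) //; last by move=> q0; apply: dn0.
congr (_ + _); case: p mE => [|p] mE; first exact: linear0.
by apply: emb_umon => //; lia.
Qed.

(** In degree 0 an operator of degree -1 vanishes, as the convention of [updown]
    requires. *)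
Lemma bB_s_emb0 (z : Cn C 0) : @bB_s k C (emb z) = 0.
Proof.
apply: emb_vanish => // p q x mE.
have [p0 q0] : p = 0%N /\ q = 0%N by lia.
rewrite /= bB_s_mono p0 addr0 bV_inc (dn0 _ _ q0).
by rewrite !linear0.
Qed.

Lemma emb_delta m (z : Cnn C m.+1) : emb (delta z) = @delta_s k C (emb z).
Proof.
apply: emb_ulift => // p q x mE; rewrite /= delta_s_mono /dcol bV_inc b'V_inc.
by case: odd; rewrite (emb_umon_pred (q := q)) ?linearN // => q0;
  rewrite dn0 ?oppr0.
Qed.

Lemma delta_s_emb0 (z : Cnn C 0) : @delta_s k C (emb z) = 0.
Proof.
apply: emb_vanish => // p q x mE.
have q0 : q = 0%N by lia.
rewrite /= delta_s_mono /dcol bV_inc b'V_inc !(dn0 _ _ q0).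
by rewrite !linear0; case: odd; rewrite linear0.
Qed.

Lemma emb_phi m (z : Cnn C m) : emb (phi iota z) = @phi_s k iota C (emb z).
Proof.
apply: emb_ulift => // p q x mE; rewrite /= phi_s_mono /phicol hatV_inc DhatV_inc.
by case: odd; rewrite emb_umon ?linearN //; lia.
Qed.

Lemma emb_phidelta m (z : Cnn C m) :
  emb (phidelta iota z) = @phi_s k iota C (delta_s (emb z)).
Proof.
case: m z => [|m] z /=; last by rewrite /phidelta /= emb_phi emb_delta.
by rewrite delta_s_emb0 /phidelta /= !linear0.
Qed.

(** By nilpotence the truncated sum satisfies the equation of [R_s_unique]. *)
Lemma emb_series m (z : Cnn C m) :
  emb (phidelta_series iota z) = @R_s k iota C (emb z).
Proof.
pose y j := iter j (@phidelta k C iota m) z.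
apply: R_s_unique; rewrite /phidelta_series.
have -> : phi_s iota (delta_s (emb (\sum_(j < m.+1) y j))) =
    \sum_(j < m.+1) emb (y j.+1).
  rewrite [emb _]linear_sum /= [delta_s _]linear_sum /= [LHS]linear_sum /=.
  by apply: eq_bigr => j _; rewrite -emb_phidelta.
rewrite -linear_sum -[RHS]linearD /=; congr (emb _).
have := phidelta_nilp iota z => nil.
rewrite -[LHS]addr0 -[X in _ + X]nil.
rewrite -(big_ord_recr m.+1 (fun j => iter j (@phidelta k C iota m) z)).
by rewrite big_ord_recl.
Qed.

Lemma emb_J m (z : Cnn C m) : emb (Jmap z) = @J_s k C (emb z).
Proof.
apply: emb_ulift => // n q x mE; rewrite /= J_s_mono s'V_inc one_tauV_inc.
have := odd_double_half n; case: odd => nE; rewrite emb_umon //; lia.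
Qed.

Lemma emb_I m (z : Cn C m) : emb (Imap z) = @I_s k C (emb z).
Proof.
apply: emb_ulift => // p q x mE; rewrite /= I_s_mono NV_inc s'V_inc.
case: p mE => [|p] mE; first by rewrite addr0 emb_umon //; lia.
rewrite linearD /= !emb_umon ?mul2n //; lia.
Qed.

Lemma emb_nu0 m (x : C m) : emb (nu0_n iota x) = @nu0_s k iota C (inc x).
Proof.
rewrite /nu0_n emb_J /nu0_nn emb_series /nu emb_umon // ?muln0 //.
by rewrite -NhatV_inc.
Qed.

Lemma emb_phi_n m (z : Cn C m) : emb (phi_n iota z) = @phi_n_s k iota C (emb z).
Proof. by rewrite /phi_n emb_J emb_series emb_phi emb_I. Qed.

Section Quasi.
Variable HC : quasi_precyclic C.

Lemma invTV_inc q (x : C q) : invTV HC (inc x) = inc (invT HC x).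
Proof. exact: (level_op_inc (fun m => @invT k C HC m)). Qed.

Lemma one_TV_inc q (x : C q) : one_TV (inc x) = inc (one_T x).
Proof. exact: (level_op_inc (fun m => @one_T k C m)). Qed.

Lemma piV_inc q (x : C q) : piV HC (inc x) = inc (piT x).
Proof. by rewrite piVE invTV_inc one_TV_inc (piTE HC) [RHS]linearB. Qed.

Lemma emb_piT m (z : Cn C m) : emb (piT_natural z) = lift_s (piV HC) (emb z).
Proof.
apply: emb_ulift => // p q x mE; rewrite /= lift_mono /= piV_inc.
exact: emb_umon.
Qed.

Lemma emb_h m (z : Cn C m) : emb (hmap z) = h_s HC (emb z).
Proof.
apply: emb_ulift => // p q x mE; rewrite emb_umon //; last by lia.
apply/funext => n; rewrite /= /h_s /mono; case: eqP => _; last first.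
  by rewrite !linear0.
by rewrite invTV_inc BV_inc linearN.
Qed.

Lemma emb_phiT m (z : Cn C m) : emb (phiT_n iota z) = phiT_s iota HC (emb z).
Proof. by rewrite linearD /= emb_h emb_phi_n emb_piT. Qed.

Lemma phiT_n_linear m : linear (@phiT_n k C iota m).
Proof.
move=> a z w; apply: emb_inj; apply: etrans (emb_phiT _) _.
apply: etrans (congr1 (phiT_s iota HC) (emb_linear a z w)) _.
apply: etrans (phiT_s_linear iota HC a (emb z) (emb w)) _.
apply: etrans _ (esym (emb_linear _ _ _)).
exact: (esym (congr2 (fun u v => a *: u + v) (emb_phiT z) (emb_phiT w))).
Qed.

Lemma emb_nuT m (x : C m) :
  emb (nuT_n iota (pi_lambda x)) = nuT_s iota HC (inc x).
Proof.
rewrite /nuT_n emb_piT emb_nu0.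
have /eqP/coker_piP[y /= xy] := coker_reprK (pi_lambda x).
have -> : coker_repr (pi_lambda x) = one_tau y + x by rewrite -xy subrK.
rewrite -[LHS]/(nuT_s iota HC _) (linearD (@inc k C m)) /= -one_tauV_inc.
by rewrite [LHS]linearD /= nuT_s_one_tau add0r.
Qed.

Lemma nuT_n_linear m a (x y : C m) :
  nuT_n iota (a *: pi_lambda x + pi_lambda y) =
    a *: nuT_n iota (pi_lambda x) + nuT_n iota (pi_lambda y).
Proof.
have <- : pi_lambda (a *: x + y) = a *: pi_lambda x + pi_lambda y by apply: linearP.
apply: emb_inj; apply: etrans (emb_nuT _) _.
apply: etrans (congr1 (nuT_s iota HC) (inc_linear a x y)) _.
apply: etrans (linearP (nuT_s iota HC) a (inc x) (inc y)) _.
apply: etrans _ (esym (emb_linear _ _ _)).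
exact: (esym (congr2 (fun u v => a *: u + v) (emb_nuT x) (emb_nuT y))).
Qed.

End Quasi.

Lemma pi_naturalE m (z : Cn C m) : pi_natural z = pi_lambda (emb z 0 m).
Proof.
have -> : emb z 0 m = \sum_(i < (m %/ 2).+1)
    (if i == 0%N :> nat then regrade m (dsum_nth i z) else 0).
  rewrite /emb /ulift fct_sumE.
  rewrite (big_morph (fun v : V => v m) (id1 := 0) (op1 := +%R)) //.
  by apply: eq_bigr => i _; rewrite /mono eq_sym; case: ifP.
rewrite /pi_lambda linear_sum; apply: eq_bigr => i _ /=.
by case: ifP => // _; rewrite linear0.
Qed.

Lemma pi_lambda_one_tau m (w : C m) : pi_lambda (one_tau w) = 0.
Proof.
rewrite -[RHS](linear0 (@coker_pi k (C m) (@one_tau k C m))).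
by apply/eqP/coker_piP; exists w; rewrite subr0.
Qed.

Lemma b_lambdaE m (x : C m.+1) : b_lambda (pi_lambda x) = pi_lambda (bop x).
Proof.
have /eqP/coker_piP[y /= xy] := coker_reprK (pi_lambda x).
rewrite /b_lambda; apply/eqP/coker_piP; exists (bop' y).
by rewrite -linearB /= xy bop_one_tau.
Qed.

Lemma pi_lambda_surj m (z : Clambda C m) : exists x, z = pi_lambda x.
Proof. by exists (coker_repr z); rewrite -[LHS]coker_reprK. Qed.

(** The only term with a shift in u comes from B, whose values lie in the range
    of 1 - tau. *)
Lemma pi_natural_bB m (z : Cn C m.+1) :
  pi_natural (bB z) = b_lambda (pi_natural z).
Proof.
rewrite !pi_naturalE b_lambdaE emb_bB /bB_s gprodDE.
rewrite [LHS]linearD /= -[RHS]addr0; congr (_ + _).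
exact: pi_lambda_one_tau.
Qed.

Lemma pi_natural_linear m : linear (@pi_natural k C m).
Proof. by move=> a x y; rewrite !pi_naturalE linearP [LHS]linearP. Qed.

End Transport.

(** * The deformation retract *)

Theorem proposition10p4 (k : nzRingType) (iota : {rmorphism rat -> k})
    (C : hunital k) (HC : quasi_precyclic C) :
  [/\ chain_map (@b_lambda k C) (@bB k C) (@nuT_n k C iota),
      forall m (x : Clambda C m), pi_natural (nuT_n iota x) = x,
      homotopy_to_id (@bB k C) (@phiT_n k C iota)
        (fun m z => nuT_n iota (pi_natural z)),
      forall m (z : Cn C m), pi_natural (phiT_n iota z) = 0
    & deformation_retract (@bB k C) (@b_lambda k C)
        (@pi_natural k C) (@nuT_n k C iota)].
Proof.
have pi_nu m (x : Clambda C m) : pi_natural (nuT_n iota x) = x.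
  have [y ->] := pi_lambda_surj x.
  rewrite pi_naturalE (emb_nuT iota HC); have [w ->] := nuT_s_coef0 iota HC (inc y).
  by rewrite gprodDE [LHS]linearD /= [X in _ + X]pi_lambda_one_tau addr0 inc_id.
have pi_phi m (z : Cn C m) : pi_natural (phiT_n iota z) = 0.
  rewrite pi_naturalE (emb_phiT iota HC); have [w ->] := phiT_s_coef0 iota HC (emb z).
  exact: pi_lambda_one_tau.
have emb_nupi m (z : Cn C m) :
    emb (nuT_n iota (pi_natural z)) = nuT_s iota HC (emb z 0).
  by rewrite pi_naturalE (emb_nuT iota HC) -emb_degree.
have hom : homotopy_to_id (@bB k C) (@phiT_n k C iota)
    (fun m z => nuT_n iota (pi_natural z)).
  split=> [m|m z]; first exact: (phiT_n_linear iota HC).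
  apply: emb_inj.
  rewrite emb_nupi nuT_homotopy [RHS](linearD (@emb k C 2 m)).
  rewrite [in RHS](linearD (@emb k C 2 m)) /=.
  rewrite emb_bB (emb_phiT iota HC).
  congr (_ + _); case: m z => [|m] z /=; last by rewrite (emb_phiT iota HC) emb_bB.
  by rewrite bB_s_emb0 !linear0.
have nu_chain : chain_map (@b_lambda k C) (@bB k C) (@nuT_n k C iota).
  split=> [m a z w|m z].
    have [x ->] := pi_lambda_surj z; have [y ->] := pi_lambda_surj w.
    exact: nuT_n_linear.
  apply: emb_inj.
  have [x ->] := pi_lambda_surj z.
  rewrite b_lambdaE emb_bB !(emb_nuT iota HC).
  have := nuT_chain iota HC (mono 0 (inc x)); rewrite /mono /= => ->.
  by rewrite /bB_s linear0 addr0 bV_inc.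
have pi_chain : chain_map (@bB k C) (@b_lambda k C) (@pi_natural k C).
  split=> [m|m z]; [exact: pi_natural_linear | by rewrite pi_natural_bB].
by split=> //; split=> //; exists (@phiT_n k C iota).
Qed.
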